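(* (Global center.) Let $H=\frac12y^2+\frac12x^2+\frac14x^4$ and let $M_n(h)$ be the first nonzero coefficient in the expansion $d(h,\varepsilon)=\sum_{k\ge1}M_k(h)\varepsilon^k$ of the displacement function at $H=h$, $h>0$, of the deformation $X_{\lambda(\varepsilon)}$. Put $$\begin{aligned}L_n(h)=&\Big[\big(\tfrac43\lambda_{6,n}-\tfrac{320}{231}\lambda_{5,n}\big)h+\big(\tfrac{32}{21}\lambda_{6,n}-\tfrac{40}{231}\lambda_{5,n}-\tfrac87\lambda_{4,n}-\tfrac37\lambda_{3,n}+\lambda_{2,n}\big)\Big]I_2(h)\\&+\Big[\tfrac{240}{77}\lambda_{5,n}h^2+\big(-\tfrac{16}{21}\lambda_{6,n}+\tfrac{20}{231}\lambda_{5,n}+\tfrac47\lambda_{4,n}+\tfrac{12}{7}\lambda_{3,n}\big)h+\lambda_{1,n}\Big]I_0(h).\end{aligned}$$ Then for any $n\in\mathbb{N}$: if $n=3m$ with $m\in\mathbb{N}$, $$M_n(h)=L_n(h)+\tfrac{8}{1001}\lambda_{3,m}^3\Big[-(308h^2+181h+24)I_2(h)+(80h^2+12h)I_0(h)\Big],$$ and if $n$ is not a multiple of $3$, $M_n(h)=L_n(h)$.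
   Context: The perturbed system is $$X_\lambda:\quad \dot x=H_y,\qquad \dot y=-H_x+(\lambda_1+\lambda_2x^2+\lambda_3y^2+\lambda_4x^4+\lambda_5y^4+\lambda_6x^6)\,y,$$ considered along an analytic arc $\varepsilon\mapsto\lambda(\varepsilon)$ with $\lambda_j(\varepsilon)=\sum_{k=1}^\infty\lambda_{j,k}\varepsilon^k$, $1\le j\le6$ (so $\lambda_{j,k}$ denotes the coefficient of $\varepsilon^k$ in $\lambda_j$, and $\lambda_{3,m}$ that of $\varepsilon^m$ in $\lambda_3$). The ovals $\{H=h\}$, $h>0$, form the period annulus of $X_0$. The displacement function is $d(h,\varepsilon)=P(h,\varepsilon)-h$, where $P(\cdot,\varepsilon)$ is the first return map of $X_{\lambda(\varepsilon)}$ on a cross-section to the periodic orbits of the annulus, parametrized by the value $h$ of $H$; it is analytic in $h,\varepsilon$. $I_0(h)=\int_{H=h}y\,dx$ and $I_2(h)=\int_{H=h}x^2y\,dx$ are integrals over the oval oriented by the flow of $X_0$. *)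

(* Defs.v *)
From Stdlib Require Import Reals.
From Coquelicot Require Import Coquelicot.

Open Scope R_scope.

Definition Ham (x y : R) : R := / 2 * y ^ 2 + / 2 * x ^ 2 + / 4 * x ^ 4.

Definition damping (l : nat -> R) (x y : R) : R :=
  l 1%nat + l 2%nat * x ^ 2 + l 3%nat * y ^ 2
  + l 4%nat * x ^ 4 + l 5%nat * y ^ 4 + l 6%nat * x ^ 6.

Definition orbit (l : nat -> R) (T : R) (x y : R -> R) : Prop :=
  forall t : R, 0 <= t <= T ->
    is_derive x t (Derive (fun v : R => Ham (x t) v) (y t)) /\
    is_derive y t
      (- Derive (fun u : R => Ham u (y t)) (x t) + damping l (x t) (y t) * y t).

(* The closed orbit of the unperturbed system on H = h is the whole level set,
   and following it for one minimal period T gives the orientation. *)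
Definition is_oval_integral (F : R -> R -> R) (h I : R) : Prop :=
  exists (T : R) (x y : R -> R),
    0 < T /\ orbit (fun _ => 0) T x y /\ Ham (x 0) (y 0) = h /\
    (x T, y T) = (x 0, y 0) /\
    (forall t : R, 0 < t < T -> (x t, y t) <> (x 0, y 0)) /\
    is_RInt (fun t : R => F (x t) (y t) * Derive x t) 0 T I.

Definition oval_integral (F : R -> R -> R) (h : R) : R :=
  iota (is_oval_integral F h).

Definition I0 (h : R) : R := oval_integral (fun _ y : R => y) h.

Definition I2 (h : R) : R := oval_integral (fun x y : R => x ^ 2 * y) h.

Definition analytic_at (f : R -> R) (a : R) : Prop :=
  exists c : nat -> R, locally a (fun u : R => is_pseries c (u - a) (f u)).

(* Differentiating Ham (s h) = h shows that such a curve is regular and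
   transversal to the ovals; it meets the oval H = h exactly at s h. *)
Definition cross_section (s : R -> R * R) : Prop :=
  forall h : R, 0 < h ->
    analytic_at (fun u : R => fst (s u)) h /\
    analytic_at (fun u : R => snd (s u)) h /\
    Ham (fst (s h)) (snd (s h)) = h.

(* The orbit starting at s h meets the section again for the first time at s p. *)
Definition first_return (s : R -> R * R) (l : nat -> R) (h p : R) : Prop :=
  exists (T : R) (x y : R -> R),
    0 < T /\ orbit l T x y /\ (x 0, y 0) = s h /\
    0 < p /\ (x T, y T) = s p /\
    (forall t k : R, 0 < t < T -> 0 < k -> (x t, y t) <> s k).

(* The domain of the return map in eps may shrink as h varies. *)
Definition return_map (s : R -> R * R) (lam : nat -> R -> R) (P : R -> R -> R)
    : Prop :=
  forall h : R, 0 < h ->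
    locally 0 (fun eps : R =>
      first_return s (fun j : nat => lam j eps) h (P h eps)).

(* f eps = c 1 * eps + c 2 * eps ^ 2 + ... near 0; the value c 0 is not used. *)
Definition expansion (f : R -> R) (c : nat -> R) : Prop :=
  locally 0 (fun eps : R =>
    is_series (fun k : nat => c (S k) * eps ^ S k) (f eps)).

Definition first_nonzero (M : nat -> R -> R) (n : nat) : Prop :=
  (1 <= n)%nat /\
  (forall k : nat, (1 <= k < n)%nat -> forall h : R, 0 < h -> M k h = 0) /\
  (exists h : R, 0 < h /\ M n h <> 0).

(* a j k is the coefficient of eps ^ k in the j-th parameter. *)
Definition L (a : nat -> nat -> R) (n : nat) (h : R) : R :=
  ((4 / 3 * a 6%nat n - 320 / 231 * a 5%nat n) * h
   + (32 / 21 * a 6%nat n - 40 / 231 * a 5%nat n - 8 / 7 * a 4%nat n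
      - 3 / 7 * a 3%nat n + a 2%nat n)) * I2 h
  + (240 / 77 * a 5%nat n * h ^ 2
     + (- (16 / 21) * a 6%nat n + 20 / 231 * a 5%nat n + 4 / 7 * a 4%nat n
        + 12 / 7 * a 3%nat n) * h
     + a 1%nat n) * I0 h.

(* Main.v *)
Require Import Defs.
From Stdlib Require Import Reals Lra Lia.
From Coquelicot Require Import Coquelicot.

(** Along an orbit of the perturbed system the energy satisfies H' = f y^2, where f
    is the damping, so the displacement P - h is the integral of f y^2 over one turn.

    Put c for the third parameter, k = y^2 - 3 x^2 - 3 x^4, and f = c k + g. On a level
    of H the form k y dx is the differential of x y^3, so the damping c k does no work
    at first order. Off the level, k y^2 = (x y^3)' - 3 x y H', hence
    H' = c (x y^3)' - 3 c x y H' + g y^2. Substituting this equation into itself (the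
    algorithm of Francoise), the second-order term is again exact up to a multiple
    of H', because x y^4 dx is exact on a level; the third-order term is not, and
    leaves c^3 times an explicit polynomial. Integration by parts reduces g y^2 and
    that polynomial to combinations of x^2 y^2 and y^2 with coefficients polynomial in
    H. This is the exact identity [energy_balance]; its exact terms form the corrector.

    Over one turn the corrector contributes boundary values at s h and s (P h), which
    are negligible against P - h. What remains gives [displacement_estimate]:
    P - h = (lin2 + c^3 cub2) I2 + (lin0 + c^3 cub0) I0, up to an error that is small
    compared with |g| + |c|^3 + |P - h|.

    This supposes that the orbit turns once, close to the oval. In the coordinates
    (amp x, y) the ovals are circles; the angle of an orbit is monotone, and
    comparing it with the angle of the section shows that the first return is one turn
    ([return_is_one_turn]). Parametrizing by the angle also shows that the oval
    integrals are well defined ([oval_integral_value]); the closed orbit they require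
    is the return at eps = 0.

    If the displacement coefficients M_k vanish for k < n, then order by order the
    combination of I2 and I0 vanishes identically. As I2 / I0 grows like the square root
    of h, I2 and I0 are independent over the polynomials ([module_independence]), so
    c^3 has no term below order n and g has none either ([melnikov_kernel]). Hence g
    and c^3 are of order eps^n, and the estimate gives M_n: the linear part L and,
    when 3 divides n, the cubic term with the coefficient of eps^(n/3) in c. *)

Open Scope R_scope.

(** * Polynomials in x and y along curves *)

(** Syntactic polynomials in x and y: their partial derivatives are computed,
    and bounds on boxes and smoothness along curves hold by one induction. *)
Inductive bipoly :=
| BX | BY | BC (c : R)
| BAdd (p q : bipoly) | BMul (p q : bipoly) | BPow (p : bipoly) (n : nat).

Declare Scope bipoly_scope.
Delimit Scope bipoly_scope with bp.
Bind Scope bipoly_scope with bipoly.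
Notation "p + q" := (BAdd p q) : bipoly_scope.
Notation "p * q" := (BMul p q) : bipoly_scope.
Notation "p ^ n" := (BPow p n) : bipoly_scope.
Coercion BC : R >-> bipoly.

Fixpoint ev (p : bipoly) (x y : R) : R :=
  match p with
  | BX => x
  | BY => y
  | BC c => c
  | BAdd p q => ev p x y + ev q x y
  | BMul p q => ev p x y * ev q x y
  | BPow p n => ev p x y ^ n
  end.

Fixpoint ddx (p : bipoly) : bipoly :=
  match p with
  | BX => BC 1
  | BY => BC 0
  | BC _ => BC 0
  | BAdd p q => BAdd (ddx p) (ddx q)
  | BMul p q => BAdd (BMul (ddx p) q) (BMul p (ddx q))
  | BPow p n => BMul (BMul (BC (INR n)) (ddx p)) (BPow p (pred n))
  end.

Fixpoint ddy (p : bipoly) : bipoly :=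
  match p with
  | BX => BC 0
  | BY => BC 1
  | BC _ => BC 0
  | BAdd p q => BAdd (ddy p) (ddy q)
  | BMul p q => BAdd (BMul (ddy p) q) (BMul p (ddy q))
  | BPow p n => BMul (BMul (BC (INR n)) (ddy p)) (BPow p (pred n))
  end.

Lemma is_derive_value (f : R -> R) (t d d' : R) :
  is_derive f t d -> d = d' -> is_derive f t d'.
Proof. now intros H <-. Qed.

Lemma Derive_eq (f : R -> R) (t d : R) :
  is_derive f t d -> Derive (fun u => f u) t = d.
Proof. apply is_derive_unique. Qed.

Lemma ev_derive (p : bipoly) (x y : R -> R) (t x' y' : R) :
  is_derive x t x' -> is_derive y t y' ->
  is_derive (fun u => ev p (x u) (y u)) t
    (ev (ddx p) (x t) (y t) * x' + ev (ddy p) (x t) (y t) * y').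
Proof.
  intros Hx Hy; induction p as [ | | c | p IHp q IHq | p IHp q IHq | p IHp n]; simpl.
  - apply (is_derive_value _ _ _ _ Hx); ring.
  - apply (is_derive_value _ _ _ _ Hy); ring.
  - apply (is_derive_value _ _ _ _ (is_derive_const c t)); unfold zero; simpl; ring.
  - apply (is_derive_value _ _ _ _ (is_derive_plus _ _ _ _ _ IHp IHq)).
    unfold plus; simpl; ring.
  - apply (is_derive_value _ _ _ _
      (is_derive_mult _ _ _ _ _ IHp IHq (fun a b => Rmult_comm a b))).
    unfold plus, mult; simpl; ring.
  - apply (is_derive_value _ _ _ _ (is_derive_pow _ n _ _ IHp)); ring.
Qed.

Lemma ev_bounded (p : bipoly) (A : R) :
  exists C, 0 <= C /\
    forall x y, Rabs x <= A -> Rabs y <= A -> Rabs (ev p x y) <= C.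
Proof.
  induction p as [ | | c | p [C [HC IHp]] q [D [HD IHq]] | p [C [HC IHp]] q [D [HD IHq]]
                 | p [C [HC IHp]] n]; simpl.
  - exists (Rmax A 0); split;
      [apply Rmax_r | intros; eapply Rle_trans; [eassumption | apply Rmax_l]].
  - exists (Rmax A 0); split;
      [apply Rmax_r | intros; eapply Rle_trans; [eassumption | apply Rmax_l]].
  - exists (Rabs c); split; [apply Rabs_pos | intros; lra].
  - exists (C + D); split; [lra | intros x y Hx Hy].
    eapply Rle_trans; [apply Rabs_triang |].
    specialize (IHp x y Hx Hy); specialize (IHq x y Hx Hy); lra.
  - exists (C * D); split; [nra | intros x y Hx Hy].
    rewrite Rabs_mult.
    apply Rmult_le_compat; auto using Rabs_pos.
  - exists (C ^ n); split; [now apply pow_le | intros x y Hx Hy].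
    rewrite <- RPow_abs.
    apply pow_incr; split; [apply Rabs_pos | auto].
Qed.

(** * Exact integration of the energy balance *)

Definition HamP : bipoly := (/ 2 * BY ^ 2 + / 2 * BX ^ 2 + / 4 * BX ^ 4)%bp.

(** At constant energy, y dy = - (x + x^3) dx, so that
    d (x y^3) = (y^2 - 3 x^2 - 3 x^4) y dx: the damping y^2 - 3 x^2 - 3 x^4
    does no work over an oval, to first order. *)
Definition prim_null : bipoly := (BX * BY ^ 3)%bp.

(** This is -9/4 x^2 y^4 + 3/2 G, where
    G = 1/2 * int_0^(x^2) (2 H - w - w^2 / 2)^2 dw is a primitive of x y^4 dx at
    constant energy; it absorbs the second-order work of the damping
    y^2 - 3 x^2 - 3 x^4, which is therefore zero as well. *)
Definition prim_second : bipoly :=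
  ((-9 / 4) * (BX ^ 2 * BY ^ 4)
   + 3 * (HamP ^ 2 * BX ^ 2)
   + (-3 / 2) * (HamP * BX ^ 4) + (-1 / 2) * (HamP * BX ^ 6)
   + (1 / 4) * BX ^ 6 + (3 / 16) * BX ^ 8 + (3 / 80) * BX ^ 10)%bp.

(** The four primitives below are x y times a polynomial in x^2 and H; their
    coefficients solve the linear systems expressed by the four reduction lemmas
    that follow. *)
Definition prim_x4 : bipoly :=
  (BX * BY * (2 / 7 * BX ^ 2 + 1 / 7 * BX ^ 4 + (-4 / 7) * HamP))%bp.
Definition prim_y4 : bipoly :=
  (BX * BY * (10 / 231 * BX ^ 2 + 113 / 693 * BX ^ 4 + 23 / 198 * BX ^ 6
     + 1 / 44 * BX ^ 8
     + HamP * ((-20 / 231) + (-502 / 693) * BX ^ 2 + (-24 / 77) * BX ^ 4)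
     + 68 / 77 * HamP ^ 2))%bp.
Definition prim_x6 : bipoly :=
  (BX * BY * ((-8 / 21) * BX ^ 2 + 2 / 63 * BX ^ 4 + 1 / 9 * BX ^ 6
     + HamP * (16 / 21 + (-4 / 9) * BX ^ 2)))%bp.
Definition prim_cubic : bipoly :=
  (BX * BY * (48 / 1001 * BX ^ 2 + (-4 / 1001) * BX ^ 4 + 1073 / 286 * BX ^ 6
     + 2309 / 572 * BX ^ 8 + 14 / 13 * BX ^ 10
     + HamP * ((-96 / 1001) + 376 / 1001 * BX ^ 2 + (-35381 / 3003) * BX ^ 4
               + (-254 / 39) * BX ^ 6)
     + HamP ^ 2 * ((-640 / 1001) + 344 / 39 * BX ^ 2)))%bp.

Definition free_derivative (p : bipoly) (x y : R) : R :=
  ev (ddx p) x y * y - ev (ddy p) x y * (x + x ^ 3).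

(** The derivative in H, at fixed x, of the primitive G inside [prim_second]. *)
Definition even_slope (x y : R) : R := 4 * Ham x y * x ^ 2 - x ^ 4 - x ^ 6 / 3.

(** The factor of H' that is left once the first two orders in the third
    parameter have been integrated; it creates the cubic term of the theorem. *)
Definition cubic_weight (x y : R) : R := 9 * x ^ 2 * y ^ 2 - 3 / 2 * even_slope x y.
Definition null_damping (x y : R) : R := y ^ 2 - 3 * x ^ 2 - 3 * x ^ 4.

(** Integrated over an oval the left side vanishes, so this and the next three
    identities express an oval integral in terms of those of x^2 y^2 dt and y^2 dt,
    with coefficients polynomial in the energy. *)
Lemma reduce_x4 (x y : R) :
  free_derivative prim_x4 x y
  = x ^ 4 * y ^ 2 - (- (8 / 7) * (x ^ 2 * y ^ 2) + 4 / 7 * Ham x y * y ^ 2).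
Proof. unfold free_derivative, Ham; simpl; field. Qed.

Lemma reduce_y4 (x y : R) :
  free_derivative prim_y4 x y
  = y ^ 4 * y ^ 2
    - ((- (320 / 231) * Ham x y - 40 / 231) * (x ^ 2 * y ^ 2)
       + (240 / 77 * Ham x y ^ 2 + 20 / 231 * Ham x y) * y ^ 2).
Proof. unfold free_derivative, Ham; simpl; field. Qed.

Lemma reduce_x6 (x y : R) :
  free_derivative prim_x6 x y
  = x ^ 6 * y ^ 2
    - ((4 / 3 * Ham x y + 32 / 21) * (x ^ 2 * y ^ 2)
       + - (16 / 21) * Ham x y * y ^ 2).
Proof. unfold free_derivative, Ham; simpl; field. Qed.

Definition cub2 (h : R) : R := 8 / 1001 * - (308 * h ^ 2 + 181 * h + 24).
Definition cub0 (h : R) : R := 8 / 1001 * (80 * h ^ 2 + 12 * h).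

(** The source of the constants 8/1001, 308, 181, 24, 80 and 12. *)
Lemma reduce_cubic (x y : R) :
  free_derivative prim_cubic x y
  = cubic_weight x y * null_damping x y * y ^ 2
    - (cub2 (Ham x y) * (x ^ 2 * y ^ 2) + cub0 (Ham x y) * y ^ 2).
Proof.
  unfold free_derivative, cubic_weight, even_slope, null_damping, cub2, cub0, Ham.
  simpl; field.
Qed.

(** [mu2] and [mu4] measure the second and fourth parameters from the line of
    dampings proportional to y^2 - 3 x^2 - 3 x^4; that line is where the linear part
    of the displacement vanishes. *)
Definition mu2 (l : nat -> R) : R := l 2%nat + 3 * l 3%nat.
Definition mu4 (l : nat -> R) : R := l 4%nat + 3 * l 3%nat.
Definition transverse_damping (l : nat -> R) (x y : R) : R :=
  l 1%nat + mu2 l * x ^ 2 + mu4 l * x ^ 4 + l 5%nat * y ^ 4 + l 6%nat * x ^ 6.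

Definition lin2 (l : nat -> R) (h : R) : R :=
  (4 / 3 * l 6%nat - 320 / 231 * l 5%nat) * h
   + (32 / 21 * l 6%nat - 40 / 231 * l 5%nat - 8 / 7 * l 4%nat
      - 3 / 7 * l 3%nat + l 2%nat).
Definition lin0 (l : nat -> R) (h : R) : R :=
  240 / 77 * l 5%nat * h ^ 2
     + (- (16 / 21) * l 6%nat + 20 / 231 * l 5%nat + 4 / 7 * l 4%nat
        + 12 / 7 * l 3%nat) * h
     + l 1%nat.
Definition co2 (l : nat -> R) (h : R) : R := lin2 l h + l 3%nat ^ 3 * cub2 h.
Definition co0 (l : nat -> R) (h : R) : R := lin0 l h + l 3%nat ^ 3 * cub0 h.

(** Subtracting this polynomial from the energy removes every term of H' that
    is exact to leading order. *)
Definition corrector (l : nat -> R) : bipoly :=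
  (l 3%nat * prim_null + l 3%nat ^ 2 * prim_second
   + mu4 l * prim_x4 + l 5%nat * prim_y4 + l 6%nat * prim_x6 + (l 3%nat ^ 3)%R * prim_cubic)%bp.

Definition remainder (l : nat -> R) (x y : R) : R :=
  transverse_damping l x y * y ^ 2
    * (- 3 * l 3%nat * x * y + l 3%nat ^ 2 * cubic_weight x y)
  - damping l x y * y
    * (mu4 l * ev (ddy prim_x4) x y + l 5%nat * ev (ddy prim_y4) x y
       + l 6%nat * ev (ddy prim_x6) x y + l 3%nat ^ 3 * ev (ddy prim_cubic) x y).

Definition full_derivative (l : nat -> R) (p : bipoly) (x y : R) : R :=
  ev (ddx p) x y * y + ev (ddy p) x y * (- (x + x ^ 3) + damping l x y * y).

Lemma full_free (l : nat -> R) (p : bipoly) (x y : R) :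
  full_derivative l p x y
  = free_derivative p x y + ev (ddy p) x y * (damping l x y * y).
Proof. unfold full_derivative, free_derivative; ring. Qed.

Lemma damping_split (l : nat -> R) (x y : R) :
  damping l x y = l 3%nat * null_damping x y + transverse_damping l x y.
Proof. unfold damping, null_damping, transverse_damping, mu2, mu4; ring. Qed.

(** With c the third parameter, k = [null_damping] and g = [transverse_damping],
    one has H' = c k y^2 + g y^2 and (x y^3)' = k y^2 + 3 x y H', whence
    H' - c (x y^3)' = - 3 c x y H' + g y^2. Substituting this equation into its own
    right side gives the term - 3 c^2 x y (x y^3)', which is exact up to x y^4 dx, and
    the latter is dG - (dG/dH) dH. The two factors H' that survive carry c^2, hence
    the cubic term in c. *)
Lemma recursion_identity (l : nat -> R) (x y : R) :
  damping l x y * y ^ 2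
  - l 3%nat * full_derivative l prim_null x y
  - l 3%nat ^ 2 * full_derivative l prim_second x y
  = transverse_damping l x y * y ^ 2
    + l 3%nat ^ 3 * (cubic_weight x y * null_damping x y * y ^ 2)
    + transverse_damping l x y * y ^ 2
    * (- 3 * l 3%nat * x * y + l 3%nat ^ 2 * cubic_weight x y).
Proof.
  unfold full_derivative; rewrite damping_split.
  generalize (transverse_damping l x y) (l 3%nat); intros g c.
  unfold cubic_weight, even_slope, null_damping, Ham; simpl; field.
Qed.

(** The identity behind the theorem: along any perturbed orbit the energy minus
    the corrector grows at a combination of x^2 y^2 and y^2, up to a remainder that
    is quadratic in the small quantities. *)
Lemma energy_balance (l : nat -> R) (x y : R) :
  damping l x y * y ^ 2 - full_derivative l (corrector l) x y
  = co2 l (Ham x y) * (x ^ 2 * y ^ 2) + co0 l (Ham x y) * y ^ 2 + remainder l x y.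
Proof.
  assert (Hlin : full_derivative l (corrector l) x y
    = l 3%nat * full_derivative l prim_null x y
      + l 3%nat ^ 2 * full_derivative l prim_second x y
      + mu4 l * full_derivative l prim_x4 x y + l 5%nat * full_derivative l prim_y4 x y
      + l 6%nat * full_derivative l prim_x6 x y
      + l 3%nat ^ 3 * full_derivative l prim_cubic x y).
  { unfold full_derivative, corrector; cbn [ev ddx ddy Nat.pred INR]; ring. }
  rewrite Hlin.
  pose proof (recursion_identity l x y) as Hrec.
  rewrite !(full_free l prim_x4), !(full_free l prim_y4), !(full_free l prim_x6),
    !(full_free l prim_cubic).
  rewrite reduce_x4, reduce_y4, reduce_x6, reduce_cubic.
  unfold co2, co0, remainder.
  replace (lin2 l (Ham x y)) with
    (4 / 3 * l 6%nat * Ham x y - 320 / 231 * l 5%nat * Ham x y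
     + 32 / 21 * l 6%nat - 40 / 231 * l 5%nat - 8 / 7 * mu4 l + mu2 l)
    by (unfold lin2, mu2, mu4; field).
  replace (lin0 l (Ham x y)) with
    (240 / 77 * l 5%nat * Ham x y ^ 2
     + (- (16 / 21) * l 6%nat + 20 / 231 * l 5%nat + 4 / 7 * mu4 l) * Ham x y + l 1%nat)
    by (unfold lin0, mu4; field).
  assert (Hg : transverse_damping l x y * y ^ 2 = l 1%nat * y ^ 2 + mu2 l * (x ^ 2 * y ^ 2)
     + mu4 l * (x ^ 4 * y ^ 2) + l 5%nat * (y ^ 4 * y ^ 2) + l 6%nat * (x ^ 6 * y ^ 2))
    by (unfold transverse_damping; ring).
  rewrite Hg in Hrec at 1.
  set (W := cubic_weight x y * null_damping x y * y ^ 2) in *.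
  set (RR := transverse_damping l x y * y ^ 2
    * (- 3 * l 3%nat * x * y + l 3%nat ^ 2 * cubic_weight x y)) in *.
  set (U := l 3%nat * full_derivative l prim_null x y) in *.
  set (V := l 3%nat ^ 2 * full_derivative l prim_second x y) in *.
  assert (Hwork : damping l x y * y ^ 2 = U + V
    + (l 1%nat * y ^ 2 + mu2 l * (x ^ 2 * y ^ 2) + mu4 l * (x ^ 4 * y ^ 2)
       + l 5%nat * (y ^ 4 * y ^ 2) + l 6%nat * (x ^ 6 * y ^ 2)
       + l 3%nat ^ 3 * W + RR)) by lra.
  rewrite Hwork; ring.
Qed.

(** * Bounds in terms of the parameters *)

Definition param_size (l : nat -> R) : R :=
  Rabs (l 1%nat) + Rabs (l 2%nat) + Rabs (l 3%nat)
  + Rabs (l 4%nat) + Rabs (l 5%nat) + Rabs (l 6%nat).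

(** The order of magnitude of the displacement. Along the line spanned by
    [null_damping] only the cube of the third parameter counts, because such a damping
    does no work before third order. *)
Definition displacement_scale (l : nat -> R) : R :=
  Rabs (l 1%nat) + Rabs (mu2 l) + Rabs (l 3%nat ^ 3)
  + Rabs (mu4 l) + Rabs (l 5%nat) + Rabs (l 6%nat).

Lemma param_size_ge0 (l : nat -> R) : 0 <= param_size l.
Proof.
  unfold param_size; pose proof (fun j => Rabs_pos (l j)) as H.
  pose proof (H 1%nat); pose proof (H 2%nat); pose proof (H 3%nat);
  pose proof (H 4%nat); pose proof (H 5%nat); pose proof (H 6%nat); lra.
Qed.

Lemma displacement_scale_ge0 (l : nat -> R) : 0 <= displacement_scale l.
Proof.
  unfold displacement_scale; pose proof (fun j => Rabs_pos (l j)) as H.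
  pose proof (H 1%nat); pose proof (H 5%nat); pose proof (H 6%nat).
  pose proof (Rabs_pos (mu2 l)); pose proof (Rabs_pos (mu4 l));
  pose proof (Rabs_pos (l 3%nat ^ 3)); lra.
Qed.

Lemma param_size_l3 (l : nat -> R) : Rabs (l 3%nat) <= param_size l.
Proof.
  unfold param_size; pose proof (fun j => Rabs_pos (l j)) as H.
  pose proof (H 1%nat); pose proof (H 2%nat);
  pose proof (H 4%nat); pose proof (H 5%nat); pose proof (H 6%nat); lra.
Qed.

Lemma lincomb_bound (K c1 c2 c3 c4 c5 c6 a1 a2 a3 a4 a5 a6 : R) :
  Rabs c1 <= K -> Rabs c2 <= K -> Rabs c3 <= K ->
  Rabs c4 <= K -> Rabs c5 <= K -> Rabs c6 <= K ->
  Rabs (c1 * a1 + c2 * a2 + c3 * a3 + c4 * a4 + c5 * a5 + c6 * a6)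
  <= K * (Rabs a1 + Rabs a2 + Rabs a3 + Rabs a4 + Rabs a5 + Rabs a6).
Proof.
  intros H1 H2 H3 H4 H5 H6.
  assert (Hterm : forall c a, Rabs c <= K -> Rabs (c * a) <= K * Rabs a).
  { intros c a Hc; rewrite Rabs_mult; apply Rmult_le_compat_r; [apply Rabs_pos | exact Hc]. }
  assert (Hadd : forall u v A B, Rabs u <= A -> Rabs v <= B -> Rabs (u + v) <= A + B).
  { intros u v A B Hu Hv; pose proof (Rabs_triang u v); lra. }
  rewrite !Rmult_plus_distr_l; repeat apply Hadd; auto.
Qed.

Lemma ham_coordinates (x y : R) :
  0 <= Ham x y /\ x ^ 2 <= 2 * Ham x y /\ y ^ 2 <= 2 * Ham x y
  /\ x ^ 4 <= 4 * Ham x y.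
Proof.
  unfold Ham.
  assert (0 <= x ^ 2) by (apply pow2_ge_0).
  assert (0 <= y ^ 2) by (apply pow2_ge_0).
  assert (0 <= x ^ 4) by (replace (x ^ 4) with ((x ^ 2) ^ 2) by ring; apply pow2_ge_0).
  repeat split; lra.
Qed.

Lemma damping_bound (l : nat -> R) (x y : R) :
  Rabs (damping l x y) <= 8 * (1 + Ham x y) ^ 2 * param_size l.
Proof.
  destruct (ham_coordinates x y) as (H0 & Hx & Hy & Hx4).
  set (H := Ham x y) in *.
  assert (0 <= x ^ 2) by (apply pow2_ge_0).
  assert (0 <= y ^ 2) by (apply pow2_ge_0).
  assert (0 <= x ^ 4) by (replace (x ^ 4) with ((x ^ 2) ^ 2) by ring; apply pow2_ge_0).
  assert (0 <= y ^ 4 <= 4 * H ^ 2) by (replace (y ^ 4) with ((y ^ 2) ^ 2) by ring; nra).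
  assert (0 <= x ^ 6 <= 8 * H ^ 2) by (replace (x ^ 6) with (x ^ 2 * x ^ 4) by ring; nra).
  replace (damping l x y) with (1 * l 1%nat + x ^ 2 * l 2%nat + y ^ 2 * l 3%nat
     + x ^ 4 * l 4%nat + y ^ 4 * l 5%nat + x ^ 6 * l 6%nat)
    by (unfold damping; ring).
  apply lincomb_bound; (rewrite Rabs_pos_eq; [nra | lra]).
Qed.

Lemma box_of_energy (x y h : R) :
  Ham x y <= h -> Rabs x <= h + 1 /\ Rabs y <= h + 1.
Proof.
  intros Hh; destruct (ham_coordinates x y) as (H0 & Hx & Hy & _).
  split; apply Rabs_le; nra.
Qed.

Lemma ev_bounded_list (ps : list bipoly) (A : R) :
  exists K, 1 <= K /\
    forall x y, Rabs x <= A -> Rabs y <= A ->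
      List.Forall (fun p => Rabs (ev p x y) <= K) ps.
Proof.
  induction ps as [ | p ps [K [HK IH]]].
  - exists 1; split; [lra | constructor].
  - destruct (ev_bounded p A) as [C [HC Hp]].
    exists (K + C); split; [lra | intros x y Hx Hy; constructor].
    + specialize (Hp x y Hx Hy); lra.
    + apply List.Forall_impl with (2 := IH x y Hx Hy); simpl; intros; lra.
Qed.

Definition cubic_weightP : bipoly :=
  (9 * (BX ^ 2 * BY ^ 2) + (-3 / 2) * (4 * HamP * BX ^ 2 + (-1) * BX ^ 4 + (-1 / 3) * BX ^ 6))%bp.

(** Each term of the remainder has a factor from [transverse_damping] or from the
    cube of the third parameter, and one more small factor. *)
Lemma remainder_bound (A : R) :
  exists C, 0 <= C /\ forall l x y,
    param_size l <= 1 -> Rabs x <= A -> Rabs y <= A ->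
    Rabs (remainder l x y) <= C * param_size l * displacement_scale l.
Proof.
  destruct (ev_bounded_list
    (BC 0 :: BC 1 :: BY :: BX ^ 2 :: BY ^ 2 :: BX ^ 4 :: BY ^ 4 :: BX ^ 6
     :: BX * BY :: cubic_weightP
     :: ddy prim_x4 :: ddy prim_y4 :: ddy prim_x6 :: ddy prim_cubic :: nil)%bp%list A) as [K [HK HP]].
  exists (5 * K ^ 3); split; [pose proof (pow_le K 3); lra |].
  intros l x y Hl Hx Hy.
  specialize (HP x y Hx Hy).
  repeat match goal with H : List.Forall _ (_ :: _) |- _ => inversion_clear H end.
  assert (HW : ev cubic_weightP x y = cubic_weight x y)
    by (unfold cubic_weight, even_slope, Ham; simpl; field).
  rewrite HW in *.
  cbn [ev] in H, H0, H1, H2, H3, H4, H5, H6, H7.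
  pose proof (param_size_ge0 l) as Hs0; pose proof (displacement_scale_ge0 l) as Hr0.
  pose proof (param_size_l3 l) as Hl3.
  assert (Hmul : forall u v a b, Rabs u <= a -> Rabs v <= b -> Rabs (u * v) <= a * b).
  { intros u v a b Hu Hv; rewrite Rabs_mult; apply Rmult_le_compat; auto using Rabs_pos. }
  assert (Hg : Rabs (transverse_damping l x y) <= K * displacement_scale l).
  { replace (transverse_damping l x y) with
      (1 * l 1%nat + x ^ 2 * mu2 l + 0 * l 3%nat ^ 3 + x ^ 4 * mu4 l
       + y ^ 4 * l 5%nat + x ^ 6 * l 6%nat) by (unfold transverse_damping; ring).
    apply lincomb_bound; assumption. }
  assert (Hf : Rabs (damping l x y) <= K * param_size l).
  { replace (damping l x y) with (1 * l 1%nat + x ^ 2 * l 2%nat + y ^ 2 * l 3%nat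
     + x ^ 4 * l 4%nat + y ^ 4 * l 5%nat + x ^ 6 * l 6%nat)
    by (unfold damping; ring).
    apply lincomb_bound; assumption. }
  assert (He : Rabs (mu4 l * ev (ddy prim_x4) x y + l 5%nat * ev (ddy prim_y4) x y
       + l 6%nat * ev (ddy prim_x6) x y + l 3%nat ^ 3 * ev (ddy prim_cubic) x y) <= K * displacement_scale l).
  { match goal with |- Rabs ?e <= _ => replace e with
      (0 * l 1%nat + 0 * mu2 l + ev (ddy prim_cubic) x y * l 3%nat ^ 3 + ev (ddy prim_x4) x y * mu4 l
       + ev (ddy prim_y4) x y * l 5%nat + ev (ddy prim_x6) x y * l 6%nat) by ring end.
    apply lincomb_bound; assumption. }
  assert (Ht : Rabs (- 3 * l 3%nat * x * y + l 3%nat ^ 2 * cubic_weight x y) <= 4 * K * param_size l).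
  { assert (Ha : Rabs (-3 * l 3%nat * (x * y)) <= 3 * param_size l * K).
    { apply Hmul; [| assumption]. rewrite Rabs_mult.
      replace (Rabs (-3)) with 3 by (rewrite Rabs_left; lra). lra. }
    assert (Hb : Rabs (l 3%nat ^ 2 * cubic_weight x y) <= param_size l * K).
    { apply Hmul; [| assumption]. rewrite <- RPow_abs.
      pose proof (Rabs_pos (l 3%nat)). simpl. rewrite Rmult_1_r.
      apply Rle_trans with (param_size l * 1); [| lra].
      apply Rmult_le_compat; lra. }
    replace (-3 * l 3%nat * x * y) with (-3 * l 3%nat * (x * y)) by ring.
    eapply Rle_trans; [apply Rabs_triang |]; lra. }
  unfold remainder, Rminus.
  eapply Rle_trans; [apply Rabs_triang |]; rewrite Rabs_Ropp.
  assert (Hfirst : Rabs (transverse_damping l x y * y ^ 2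
    * (- 3 * l 3%nat * x * y + l 3%nat ^ 2 * cubic_weight x y))
    <= K * displacement_scale l * K * (4 * K * param_size l))
    by (apply Hmul; [apply Hmul; assumption | assumption]).
  assert (Hsecond : Rabs (damping l x y * y *
    (mu4 l * ev (ddy prim_x4) x y + l 5%nat * ev (ddy prim_y4) x y
       + l 6%nat * ev (ddy prim_x6) x y + l 3%nat ^ 3 * ev (ddy prim_cubic) x y))
    <= K * param_size l * K * (K * displacement_scale l))
    by (apply Hmul; [apply Hmul; assumption | assumption]).
  lra.
Qed.

Lemma co_bound (l : nat -> R) (A h : R) :
  1 <= A -> 0 <= h <= A ->
  Rabs (co2 l h) <= 5 * A ^ 2 * displacement_scale l /\
  Rabs (co0 l h) <= 5 * A ^ 2 * displacement_scale l.
Proof.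
  intros HA Hh; split.
  - replace (co2 l h) with
      (0 * l 1%nat + 1 * mu2 l + cub2 h * l 3%nat ^ 3 + - (8 / 7) * mu4 l
       + (- (320 / 231) * h - 40 / 231) * l 5%nat + (4 / 3 * h + 32 / 21) * l 6%nat)
      by (unfold co2, lin2, mu2, mu4; field).
    apply lincomb_bound; apply Rabs_le; unfold cub2; nra.
  - replace (co0 l h) with
      (1 * l 1%nat + 0 * mu2 l + cub0 h * l 3%nat ^ 3 + 4 / 7 * h * mu4 l
       + (240 / 77 * h ^ 2 + 20 / 231 * h) * l 5%nat + - (16 / 21) * h * l 6%nat)
      by (unfold co0, lin0, mu2, mu4; field).
    apply lincomb_bound; apply Rabs_le; unfold cub0; nra.
Qed.

Lemma co_lipschitz (l : nat -> R) (A h k : R) :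
  1 <= A -> 0 <= h <= A -> 0 <= k <= A ->
  Rabs (co2 l h - co2 l k) <= 7 * A * Rabs (h - k) * displacement_scale l /\
  Rabs (co0 l h - co0 l k) <= 7 * A * Rabs (h - k) * displacement_scale l.
Proof.
  intros HA Hh Hk.
  assert (Hc : forall c, Rabs c <= 7 * A -> Rabs (c * (h - k)) <= 7 * A * Rabs (h - k)).
  { intros c Hc; rewrite Rabs_mult; apply Rmult_le_compat_r; [apply Rabs_pos | exact Hc]. }
  split.
  - replace (co2 l h - co2 l k) with
      (0 * (h - k) * l 1%nat + 0 * (h - k) * mu2 l
       + 8 / 1001 * - (308 * (h + k) + 181) * (h - k) * l 3%nat ^ 3
       + 0 * (h - k) * mu4 l
       + - (320 / 231) * (h - k) * l 5%nat + 4 / 3 * (h - k) * l 6%nat)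
      by (unfold co2, lin2, cub2, mu2, mu4; field).
    apply lincomb_bound; apply Hc; apply Rabs_le; lra.
  - replace (co0 l h - co0 l k) with
      (0 * (h - k) * l 1%nat + 0 * (h - k) * mu2 l
       + 8 / 1001 * (80 * (h + k) + 12) * (h - k) * l 3%nat ^ 3
       + 4 / 7 * (h - k) * mu4 l
       + (240 / 77 * (h + k) + 20 / 231) * (h - k) * l 5%nat
       + - (16 / 21) * (h - k) * l 6%nat)
      by (unfold co0, lin0, cub0, mu2, mu4; field).
    apply lincomb_bound; apply Hc; apply Rabs_le; lra.
Qed.

(** * Energy along the orbits *)

Lemma is_derive_continuity (f : R -> R) (t d : R) :
  is_derive f t d -> continuity_pt f t.
Proof.
  intros Hf; apply continuity_pt_filterlim.
  apply (ex_derive_continuous (V := R_NormedModule)); now exists d.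
Qed.

Lemma mean_value_bound (f df : R -> R) (a b B : R) :
  a <= b -> (forall t, a <= t <= b -> is_derive f t (df t)) ->
  (forall t, a <= t <= b -> Rabs (df t) <= B) ->
  Rabs (f b - f a) <= B * (b - a).
Proof.
  intros Hab Hd HB.
  destruct (MVT_gen f a b df) as [c [Hc Heq]].
  - rewrite Rmin_left, Rmax_right by lra; intros t Ht; apply Hd; lra.
  - rewrite Rmin_left, Rmax_right by lra; intros t Ht.
    apply is_derive_continuity with (df t), Hd, Ht.
  - rewrite Rmin_left, Rmax_right in Hc by lra.
    rewrite Heq, Rabs_mult, (Rabs_pos_eq (b - a)) by lra.
    apply Rmult_le_compat_r; [lra | auto].
Qed.

Lemma monotone_of_derive (f df : R -> R) (a b : R) :
  a <= b -> (forall t, a <= t <= b -> is_derive f t (df t)) ->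
  (forall t, a <= t <= b -> 0 <= df t) -> f a <= f b.
Proof.
  intros Hab Hd HB.
  destruct (MVT_gen f a b df) as [c [Hc Heq]].
  - rewrite Rmin_left, Rmax_right by lra; intros t Ht; apply Hd; lra.
  - rewrite Rmin_left, Rmax_right by lra; intros t Ht.
    apply is_derive_continuity with (df t), Hd, Ht.
  - rewrite Rmin_left, Rmax_right in Hc by lra.
    pose proof (HB c Hc); nra.
Qed.

Lemma ham_ev (x y : R) : Ham x y = ev HamP x y.
Proof. unfold Ham; simpl; ring. Qed.

Lemma orbit_velocity (l : nat -> R) (T : R) (x y : R -> R) (t : R) :
  orbit l T x y -> 0 <= t <= T ->
  is_derive x t (y t) /\
  is_derive y t (- (x t + x t ^ 3) + damping l (x t) (y t) * y t).
Proof.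
  intros Ho Ht; destruct (Ho t Ht) as [Hx Hy].
  assert (HDy : Derive (fun v => Ham (x t) v) (y t) = y t).
  { apply is_derive_unique; unfold Ham; auto_derive; [trivial | simpl; field]. }
  assert (HDx : Derive (fun u => Ham u (y t)) (x t) = x t + x t ^ 3).
  { apply is_derive_unique; unfold Ham; auto_derive; [trivial | simpl; field]. }
  rewrite HDy in Hx; rewrite HDx in Hy; auto.
Qed.

Lemma orbit_ev_derive (l : nat -> R) (T : R) (x y : R -> R) (p : bipoly) (t : R) :
  orbit l T x y -> 0 <= t <= T ->
  is_derive (fun u => ev p (x u) (y u)) t (full_derivative l p (x t) (y t)).
Proof.
  intros Ho Ht; destruct (orbit_velocity _ _ _ _ _ Ho Ht) as [Hx Hy].
  exact (ev_derive p x y t _ _ Hx Hy).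
Qed.

Lemma orbit_energy_derive (l : nat -> R) (T : R) (x y : R -> R) (t : R) :
  orbit l T x y -> 0 <= t <= T ->
  is_derive (fun u => Ham (x u) (y u)) t (damping l (x t) (y t) * y t ^ 2).
Proof.
  intros Ho Ht.
  apply is_derive_ext with (fun u => ev HamP (x u) (y u)).
  { intros u; symmetry; apply ham_ev. }
  apply (is_derive_value _ _ _ _ (orbit_ev_derive _ _ _ _ HamP _ Ho Ht)).
  unfold full_derivative; simpl; field.
Qed.

Lemma orbit_restrict (l : nat -> R) (T S : R) (x y : R -> R) :
  S <= T -> orbit l T x y -> orbit l S x y.
Proof. intros HS Ho t Ht; apply Ho; lra. Qed.

(** The growth of H is at most of order (1 + H)^3, so (1 + H)^-2 has bounded slope.
    Working with this quantity excludes blow-up without assuming beforehand that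
    the orbit stays in a bounded region. *)
Lemma energy_inverse_square (l : nat -> R) (T : R) (x y : R -> R) (t : R) :
  orbit l T x y -> 0 <= t <= T ->
  Rabs (/ (1 + Ham (x t) (y t)) ^ 2 - / (1 + Ham (x 0) (y 0)) ^ 2)
  <= 32 * param_size l * t.
Proof.
  intros Ho Ht.
  set (E := fun u => Ham (x u) (y u)).
  assert (HE : forall u, 0 <= E u) by (intros u; apply ham_coordinates).
  replace (32 * param_size l * t) with (32 * param_size l * (t - 0)) by ring.
  apply (mean_value_bound (fun u => / (1 + E u) ^ 2)
    (fun u => - 2 * (damping l (x u) (y u) * y u ^ 2) / (1 + E u) ^ 3)); [lra | |].
  - intros u Hu.
    assert (HEu := orbit_energy_derive _ _ _ _ u Ho ltac:(lra)).
    change (is_derive E u (damping l (x u) (y u) * y u ^ 2)) in HEu.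
    specialize (HE u).
    auto_derive.
    + split; [now exists (damping l (x u) (y u) * y u ^ 2) | split; [nra | trivial]].
    + rewrite (Derive_eq _ _ _ HEu); field; lra.
  - intros u Hu; specialize (HE u).
    pose proof (damping_bound l (x u) (y u)) as Hd.
    destruct (ham_coordinates (x u) (y u)) as (_ & _ & Hy & _).
    change (Ham (x u) (y u)) with (E u) in *.
    pose proof (param_size_ge0 l).
    assert (0 <= y u ^ 2) by (apply pow2_ge_0).
    assert (0 < (1 + E u) ^ 3) by (apply pow_lt; lra).
    unfold Rdiv; rewrite !Rabs_mult, Rabs_inv, (Rabs_left (-2)) by lra.
    rewrite (Rabs_pos_eq (y u ^ 2)), (Rabs_pos_eq ((1 + E u) ^ 3)) by lra.
    apply Rmult_le_reg_r with ((1 + E u) ^ 3); [assumption |].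
    rewrite Rmult_assoc, Rinv_l, Rmult_1_r by lra.
    apply Rle_trans with (2 * ((8 * (1 + E u) ^ 2 * param_size l) * (2 * (1 + E u)))).
    + replace (- -2) with 2 by ring.
      apply Rmult_le_compat_l; [lra |].
      apply Rmult_le_compat; auto using Rabs_pos; lra.
    + apply Req_le; ring.
Qed.

(** Times up to 36 suffice, since 36 exceeds 9 PI and a turn takes at most 8 PI. *)
Lemma energy_close (h d : R) :
  0 < h -> 0 < d ->
  exists C s0, 0 <= C /\ 0 < s0 /\
    forall l T x y, param_size l <= s0 -> T <= 36 -> orbit l T x y -> Ham (x 0) (y 0) = h ->
    forall t, 0 <= t <= T ->
      Rabs (Ham (x t) (y t) - h) <= C * param_size l * t /\
      Rabs (Ham (x t) (y t) - h) <= d.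
Proof.
  intros Hh Hd.
  set (C := 16 * (2 + h) ^ 3).
  assert (HC : 0 < C) by (unfold C; assert (0 < (2 + h) ^ 3) by (apply pow_lt; lra); lra).
  set (gap := / (1 + h) ^ 2 - / (2 + h) ^ 2).
  assert (Hgap : 0 < gap).
  { unfold gap; apply Rlt_0_minus, Rinv_lt_contravar;
      [apply Rmult_lt_0_compat; apply pow_lt; lra | nra]. }
  exists C, (Rmin (gap / 2000) (d / (36 * C))); split; [lra | split].
  { apply Rmin_pos; [lra | apply Rdiv_lt_0_compat; lra]. }
  intros l T x y Hs HT Ho H0.
  assert (Hs1 : param_size l <= gap / 2000) by (eapply Rle_trans; [exact Hs | apply Rmin_l]).
  assert (Hs2 : param_size l <= d / (36 * C)) by (eapply Rle_trans; [exact Hs | apply Rmin_r]).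
  pose proof (param_size_ge0 l) as Hs0.
  assert (Hbox : forall t, 0 <= t <= T -> Ham (x t) (y t) <= h + 1).
  { intros t Ht. destruct (Rle_lt_dec (Ham (x t) (y t)) (h + 1)) as [Hle | Hgt]; [exact Hle |].
    exfalso.
    pose proof (energy_inverse_square l T x y t Ho Ht) as Hk.
    rewrite H0 in Hk.
    assert (/ (1 + Ham (x t) (y t)) ^ 2 < / (2 + h) ^ 2).
    { apply Rinv_lt_contravar; [apply Rmult_lt_0_compat; apply pow_lt; lra | nra]. }
    apply Rabs_le_between in Hk.
    assert (param_size l * t <= gap / 2000 * 36) by (apply Rmult_le_compat; lra).
    unfold gap in *; lra. }
  intros t Ht.
  assert (Hlin : Rabs (Ham (x t) (y t) - h) <= C * param_size l * t).
  { rewrite <- H0. replace (C * param_size l * t) with (C * param_size l * (t - 0)) by ring.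
    apply (mean_value_bound (fun u => Ham (x u) (y u))
       (fun u => damping l (x u) (y u) * y u ^ 2)); [lra | |].
    - intros u Hu; apply (orbit_energy_derive l T); [exact Ho | lra].
    - intros u Hu.
      pose proof (damping_bound l (x u) (y u)) as Hdb.
      destruct (ham_coordinates (x u) (y u)) as (HE & _ & Hy & _).
      specialize (Hbox u ltac:(lra)).
      rewrite Rabs_mult, (Rabs_pos_eq (y u ^ 2)) by (apply pow2_ge_0).
      apply Rle_trans with ((8 * (2 + h) ^ 2 * param_size l) * (2 * (2 + h))).
      + apply Rmult_le_compat; [apply Rabs_pos | apply pow2_ge_0 | | lra].
        eapply Rle_trans; [exact Hdb |].
        apply Rmult_le_compat_r; [lra |].
        apply Rmult_le_compat_l; [lra |]. apply pow_incr; lra.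
      + unfold C; apply Req_le; ring. }
  split; [exact Hlin |].
  eapply Rle_trans; [exact Hlin |].
  apply Rle_trans with (C * (d / (36 * C)) * 36).
  - apply Rmult_le_compat; [apply Rmult_le_pos; lra | lra | apply Rmult_le_compat_l; lra | lra].
  - apply Req_le; field; lra.
Qed.

(** * The angle around the ovals *)

(** The signed square root of x^2 + x^4 / 2, so that 2 H = amp^2 + y^2: in the
    coordinates (amp x, y) the ovals are circles. *)
Definition amp (x : R) : R := x * sqrt (1 + x ^ 2 / 2).

(** The derivative of [amp]. Since also kap * amp = x + x^3, the free flow turns
    the circles at angular speed [kap]. *)
Definition kap (x : R) : R := (1 + x ^ 2) / sqrt (1 + x ^ 2 / 2).

(** Obtained from 1 + 2 amp^2 = (1 + x^2)^2. *)
Definition amp_inv (X : R) : R := X * sqrt 2 / sqrt (1 + sqrt (1 + 2 * X ^ 2)).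

Lemma half_square_pos (x : R) : 0 < 1 + x ^ 2 / 2.
Proof. pose proof (pow2_ge_0 x); lra. Qed.

Lemma sqrt_sq (a : R) : 0 <= a -> sqrt a ^ 2 = a.
Proof. intros Ha; simpl; rewrite Rmult_1_r; now apply sqrt_sqrt. Qed.

Lemma amp_energy (x y : R) : amp x ^ 2 + y ^ 2 = 2 * Ham x y.
Proof.
  unfold amp, Ham; rewrite Rpow_mult_distr, sqrt_sq by (left; apply half_square_pos); field.
Qed.

Lemma amp_derive (x : R) : is_derive amp x (kap x).
Proof.
  pose proof (half_square_pos x) as Hp; pose proof (sqrt_lt_R0 _ Hp) as Hq.
  pose proof (sqrt_sq _ (Rlt_le _ _ Hp)) as Hs.
  unfold amp, kap; auto_derive; [simpl in *; repeat split; lra |].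
  simpl in *; rewrite Rmult_1_r in *.
  set (q := sqrt _) in *.
  apply Rmult_eq_reg_r with q; [| lra]. field_simplify; [| lra | lra]. lra.
Qed.

Lemma kap_amp (x : R) : kap x * amp x = x + x ^ 3.
Proof.
  pose proof (sqrt_lt_R0 _ (half_square_pos x)).
  unfold kap, amp; field; lra.
Qed.

Lemma kap_ge_1 (x : R) : 1 <= kap x.
Proof.
  pose proof (half_square_pos x) as Hp; pose proof (sqrt_lt_R0 _ Hp) as Hq.
  pose proof (sqrt_sq _ (Rlt_le _ _ Hp)) as Hs; pose proof (pow2_ge_0 x).
  unfold kap; apply Rmult_le_reg_r with (sqrt (1 + x ^ 2 / 2)); [exact Hq |].
  unfold Rdiv at 2; rewrite Rmult_assoc, Rinv_l, Rmult_1_r, Rmult_1_l by lra.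
  nra.
Qed.

Lemma ampK (x : R) : amp_inv (amp x) = x.
Proof.
  pose proof (half_square_pos x) as Hp; pose proof (sqrt_lt_R0 _ Hp) as Hq.
  pose proof (pow2_ge_0 x).
  unfold amp_inv.
  replace (1 + 2 * amp x ^ 2) with ((1 + x ^ 2) ^ 2).
  2:{ unfold amp; rewrite Rpow_mult_distr, sqrt_sq by lra; field. }
  rewrite sqrt_pow2 by lra.
  replace (1 + (1 + x ^ 2)) with (2 * (1 + x ^ 2 / 2)) by field.
  rewrite sqrt_mult by lra.
  pose proof (sqrt_lt_R0 2 ltac:(lra)).
  unfold amp; field; split; lra.
Qed.

Lemma angle_exists (u v : R) :
  u ^ 2 + v ^ 2 = 1 -> exists phi, u = cos phi /\ v = sin phi.
Proof.
  intros H.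
  pose proof (pow2_ge_0 u); pose proof (pow2_ge_0 v).
  assert (Hu : -1 <= u <= 1) by nra.
  assert (Hs : sqrt (1 - u ^ 2) = Rabs v).
  { replace (1 - u ^ 2) with (Rsqr v) by (unfold Rsqr; lra). apply sqrt_Rsqr_abs. }
  destruct (Rle_lt_dec 0 v) as [Hv | Hv].
  - exists (acos u); rewrite cos_acos, sin_acos by lra; split; [easy |].
    rewrite Rsqr_pow2, Hs, Rabs_pos_eq; lra.
  - exists (- acos u); rewrite cos_neg, sin_neg, cos_acos, sin_acos by lra; split; [easy |].
    rewrite Rsqr_pow2, Hs, Rabs_left; lra.
Qed.

(** [w] may be arbitrary outside the segment, so it is first made continuous
    everywhere. *)
Lemma primitive_exists (w : R -> R) (T c : R) :
  0 <= T -> (forall t, 0 <= t <= T -> continuous w t) ->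
  exists phi, phi 0 = c /\ forall t, 0 <= t <= T -> is_derive phi t (w t).
Proof.
  intros HT Hw.
  set (we := extension_C0 w 0 T).
  assert (Hc : forall t, continuous we t).
  { apply (extension_C0_continuous w 0 T); [exact HT |]. simpl; intros; apply Hw; lra. }
  exists (fun t => c + RInt we 0 t); split.
  { rewrite RInt_point; unfold zero; simpl; ring. }
  intros t Ht.
  apply (is_derive_value _ _ (0 + we t)).
  - apply (is_derive_plus (fun _ => c)); [apply (is_derive_const c) |].
    apply (is_derive_RInt we (RInt we 0) 0); [| apply Hc].
    apply filter_forall; intros b.
    apply (RInt_correct (V := R_CompleteNormedModule)), (ex_RInt_continuous (V := R_CompleteNormedModule)).
    intros; apply Hc.
  - unfold we; rewrite extension_C0_ext; simpl; lra.
Qed.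

(** The scalar and cross products of (u, v) with the rotating unit vector are both
    constant. *)
Lemma angle_lift (u v w : R -> R) (T c : R) :
  0 <= T ->
  (forall t, 0 <= t <= T -> continuous w t) ->
  (forall t, 0 <= t <= T -> is_derive u t (- w t * v t) /\ is_derive v t (w t * u t)) ->
  u 0 = cos c -> v 0 = sin c ->
  exists phi, phi 0 = c /\ forall t, 0 <= t <= T ->
    is_derive phi t (w t) /\ u t = cos (phi t) /\ v t = sin (phi t).
Proof.
  intros HT Hw Hd Hu0 Hv0.
  destruct (primitive_exists w T c HT Hw) as [phi [Hphi0 Hphi]].
  exists phi; split; [exact Hphi0 |].
  intros t Ht.
  assert (Hzero : forall f : R -> R, (forall s, 0 <= s <= T -> is_derive f s 0) -> f t = f 0).
  { intros f Hf.
    assert (Rabs (f t - f 0) <= 0 * (t - 0)).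
    { apply (mean_value_bound f (fun _ => 0)); [lra | intros; apply Hf; lra |].
      intros; rewrite Rabs_R0; lra. }
    rewrite Rmult_0_l in H. pose proof (Rabs_pos (f t - f 0)).
    apply Rminus_diag_uniq. apply Rabs_eq_0; lra. }
  assert (HA : u t * cos (phi t) + v t * sin (phi t) = 1).
  { rewrite (Hzero (fun s => u s * cos (phi s) + v s * sin (phi s))).
    - rewrite Hu0, Hv0, Hphi0. pose proof (sin2_cos2 c); unfold Rsqr in *; lra.
    - intros s Hs; destruct (Hd s Hs) as [Hus Hvs]; specialize (Hphi s Hs).
      auto_derive.
      + repeat split; [now exists (- w s * v s) | now exists (w s) | now exists (w s * u s) | now exists (w s)].
      + rewrite (Derive_eq _ _ _ Hus).
        rewrite (Derive_eq _ _ _ Hvs).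
        rewrite (Derive_eq _ _ _ Hphi).
        ring. }
  assert (HB : v t * cos (phi t) - u t * sin (phi t) = 0).
  { rewrite (Hzero (fun s => v s * cos (phi s) - u s * sin (phi s))).
    - rewrite Hu0, Hv0, Hphi0; ring.
    - intros s Hs; destruct (Hd s Hs) as [Hus Hvs]; specialize (Hphi s Hs).
      auto_derive.
      + repeat split; [now exists (w s * u s) | now exists (w s) | now exists (- w s * v s) | now exists (w s)].
      + rewrite (Derive_eq _ _ _ Hus).
        rewrite (Derive_eq _ _ _ Hvs).
        rewrite (Derive_eq _ _ _ Hphi).
        ring. }
  pose proof (sin2_cos2 (phi t)) as Hsc; unfold Rsqr in Hsc.
  split; [now apply Hphi | split].
  - transitivity (u t * (sin (phi t) * sin (phi t) + cos (phi t) * cos (phi t))); [rewrite Hsc; ring |].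
    transitivity (cos (phi t) * (u t * cos (phi t) + v t * sin (phi t))
      - sin (phi t) * (v t * cos (phi t) - u t * sin (phi t))); [ring | rewrite HA, HB; ring].
  - transitivity (v t * (sin (phi t) * sin (phi t) + cos (phi t) * cos (phi t))); [rewrite Hsc; ring |].
    transitivity (sin (phi t) * (u t * cos (phi t) + v t * sin (phi t))
      + cos (phi t) * (v t * cos (phi t) - u t * sin (phi t))); [ring | rewrite HA, HB; ring].
Qed.

Definition on_ray (x y phi : R) : Prop :=
  amp x = sqrt (2 * Ham x y) * cos phi /\ y = sqrt (2 * Ham x y) * sin phi.

Lemma on_ray_exists (x y : R) : 0 < Ham x y -> exists phi, on_ray x y phi.
Proof.
  intros HH.
  assert (Hq : 0 < sqrt (2 * Ham x y)) by (apply sqrt_lt_R0; lra).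
  assert (Hs : sqrt (2 * Ham x y) ^ 2 = 2 * Ham x y) by (apply sqrt_sq; lra).
  destruct (angle_exists (amp x / sqrt (2 * Ham x y)) (y / sqrt (2 * Ham x y))) as [phi [H1 H2]].
  - unfold Rdiv; rewrite !Rpow_mult_distr, <- Rmult_plus_distr_r, amp_energy, pow_inv, Hs.
    field; lra.
  - exists phi; split; [rewrite <- H1 | rewrite <- H2]; field; lra.
Qed.

Lemma on_ray_inj (x y x' y' phi : R) :
  on_ray x y phi -> on_ray x' y' phi -> Ham x y = Ham x' y' -> (x, y) = (x', y').
Proof.
  intros [H1 H2] [H3 H4] HH.
  assert (Ha : amp x = amp x') by (rewrite H1, H3, HH; ring).
  f_equal; [now rewrite <- (ampK x), Ha, ampK | rewrite H2, H4, HH; ring].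
Qed.

Lemma polar_orbit (l : nat -> R) (T : R) (x y : R -> R) (c : R) :
  0 <= T -> orbit l T x y ->
  (forall t, 0 <= t <= T -> 0 < Ham (x t) (y t)) ->
  on_ray (x 0) (y 0) c ->
  exists phi, phi 0 = c /\ forall t, 0 <= t <= T ->
    on_ray (x t) (y t) (phi t) /\
    is_derive phi t
      (- kap (x t) + damping l (x t) (y t) * (amp (x t) * y t / (2 * Ham (x t) (y t)))).
Proof.
  intros HT Ho Hpos [Hc1 Hc2].
  set (E := fun t => Ham (x t) (y t)).
  set (w := fun t => - kap (x t) + damping l (x t) (y t) * (amp (x t) * y t / (2 * E t))).
  assert (HE : forall t, 0 <= t <= T -> is_derive E t (damping l (x t) (y t) * y t ^ 2))
    by (intros; now apply (orbit_energy_derive l T)).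
  assert (Hq : forall t, 0 <= t <= T -> 0 < sqrt (2 * E t)).
  { intros t Ht; apply sqrt_lt_R0; specialize (Hpos t Ht); unfold E; lra. }
  assert (Hamp : forall t, 0 <= t <= T -> is_derive (fun s => amp (x s)) t (kap (x t) * y t)).
  { intros t Ht; destruct (orbit_velocity _ _ _ _ _ Ho Ht) as [Hx _].
    apply (is_derive_value _ _ _ _ (is_derive_comp amp x t _ _ (amp_derive (x t)) Hx)).
    unfold scal; simpl; unfold mult; simpl; ring. }
  destruct (angle_lift (fun t => amp (x t) / sqrt (2 * E t)) (fun t => y t / sqrt (2 * E t))
    w T c HT) as [phi [Hphi0 Hphi]].
  - intros t Ht; destruct (orbit_velocity _ _ _ _ _ Ho Ht) as [Hx Hy].
    pose proof (Hpos t Ht) as Hp; specialize (HE t Ht); specialize (Hamp t Ht).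
    apply (ex_derive_continuous (V := R_NormedModule)).
    pose proof (half_square_pos (x t)) as Hh.
    assert (Hk : ex_derive kap (x t)).
    { unfold kap; auto_derive; simpl in Hh |- *; repeat split; try lra.
      apply Rgt_not_eq, sqrt_lt_R0; lra. }
    unfold w, damping; auto_derive; repeat split;
      try (exact Hk); try (now eexists; eassumption);
      try (eexists; apply amp_derive).
    unfold E; lra.
  - intros t Ht; destruct (orbit_velocity _ _ _ _ _ Ho Ht) as [Hx Hy].
    pose proof (Hpos t Ht) as Hp; specialize (HE t Ht); specialize (Hamp t Ht).
    specialize (Hq t Ht).
    pose proof (sqrt_sq (2 * E t) ltac:(unfold E; lra)) as Hs.
    assert (Hr : is_derive (fun s => sqrt (2 * E s)) t
              (damping l (x t) (y t) * y t ^ 2 / sqrt (2 * E t))).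
    { auto_derive; [repeat split; [now eexists; eassumption | unfold E; lra] |].
      rewrite (Derive_eq _ _ _ HE).
      field; lra. }
    pose proof (kap_amp (x t)) as Hka.
    pose proof (amp_energy (x t) (y t)) as Hae; change (Ham (x t) (y t)) with (E t) in Hae.
    assert (HEq : E t = sqrt (2 * E t) ^ 2 / 2) by lra.
    split.
    + apply (is_derive_value _ _ _ _ (is_derive_div _ _ _ _ _ Hamp Hr (Rgt_not_eq _ _ Hq))).
      unfold w, minus, plus, opp, scal; simpl; unfold mult; simpl.
      set (q := sqrt (2 * E t)) in *. rewrite HEq. field. lra.
    + apply (is_derive_value _ _ _ _ (is_derive_div _ _ _ _ _ Hy Hr (Rgt_not_eq _ _ Hq))).
      rewrite <- Hka.
      unfold w, minus, plus, opp, scal; simpl; unfold mult; simpl.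
      set (q := sqrt (2 * E t)) in *. rewrite HEq.
      assert (Hy2 : q ^ 2 - y t ^ 2 = amp (x t) ^ 2) by lra.
      transitivity ((- kap (x t) * amp (x t)) / q
         + damping l (x t) (y t) * y t * (q ^ 2 - y t ^ 2) / q ^ 3); [field; lra |].
      rewrite Hy2; field; lra.
  - unfold E; rewrite Hc1 at 1; field; apply Rgt_not_eq, Hq; lra.
  - unfold E; rewrite Hc2 at 1; field; apply Rgt_not_eq, Hq; lra.
  - exists phi; split; [exact Hphi0 |]; intros t Ht.
    destruct (Hphi t Ht) as (Hd & Hu & Hv); specialize (Hq t Ht).
    split; [| exact Hd].
    change (Ham (x t) (y t)) with (E t); unfold on_ray.
    change (Ham (x t) (y t)) with (E t).
    split; [rewrite <- Hu | rewrite <- Hv]; field; lra.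
Qed.

(** * The first return is one turn *)

Lemma pointwise_lipschitz (f : R -> R) (a d : R) :
  is_derive f a d ->
  exists K r, 0 <= K /\ 0 < r /\
    forall u, Rabs (u - a) <= r -> Rabs (f u - f a) <= K * Rabs (u - a).
Proof.
  intros Hd; apply is_derive_Reals in Hd.
  destruct (Hd 1 Rlt_0_1) as [r Hr].
  exists (Rabs d + 1), (r / 2); pose proof (cond_pos r); pose proof (Rabs_pos d).
  split; [lra | split; [lra |]].
  intros u Hu.
  destruct (Req_dec u a) as [-> | Hne].
  - rewrite !Rminus_diag, Rabs_R0; lra.
  - assert (Hq := Hr (u - a) ltac:(lra) ltac:(lra)).
    replace (a + (u - a)) with u in Hq by ring.
    set (q := (f u - f a) / (u - a)) in *.
    assert (Hf : f u - f a = q * (u - a)) by (unfold q; field; lra).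
    rewrite Hf, Rabs_mult; apply Rmult_le_compat_r; [apply Rabs_pos |].
    replace q with ((q - d) + d) by ring.
    pose proof (Rabs_triang (q - d) d); lra.
Qed.

(** A convergent series has terms tending to zero, which cannot happen outside the
    disk of convergence. *)
Lemma CV_radius_pos (c : nat -> R) (r : R) :
  0 < r -> ex_pseries c r -> Rbar_lt 0 (CV_radius c).
Proof.
  intros Hr Hc.
  destruct (Rbar_lt_le_dec (CV_radius c) (Rabs r)) as [Hlt | Hle].
  - exfalso; apply (CV_disk_outside c r Hlt).
    apply ex_pseries_R in Hc; now apply ex_series_lim_0.
  - apply Rbar_lt_le_trans with (2 := Hle); simpl; now rewrite Rabs_pos_eq; lra.
Qed.

Lemma analytic_ex_derive (f : R -> R) (a : R) :
  analytic_at f a -> ex_derive f a.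
Proof.
  intros [c [r Hr]]; pose proof (cond_pos r) as Hr0.
  assert (HCV : Rbar_lt 0 (CV_radius c)).
  { apply CV_radius_pos with (r / 2); [lra |].
    exists (f (a + r / 2)).
    assert (Hb := Hr (a + r / 2)); replace (a + r / 2 - a) with (r / 2) in Hb by ring.
    apply Hb; unfold ball; simpl; unfold AbsRing_ball, abs, minus, plus, opp; simpl.
    replace (a + r / 2 + - a) with (r / 2) by ring; rewrite Rabs_pos_eq; lra. }
  apply ex_derive_ext_loc with (fun u => PSeries c (u - a)).
  - exists r; intros u Hu; apply is_pseries_unique, Hr, Hu.
  - apply (ex_derive_comp (PSeries c) (fun u => u - a)).
    + apply ex_derive_PSeries; rewrite Rminus_diag, Rabs_R0; exact HCV.
    + auto_derive; trivial.
Qed.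

(** Turning the plane back by c puts the section near s h in the right half plane,
    where the polar angle is an arctangent. The Lipschitz bound at h
    controls the drift of the section angle by the energy drift of an orbit. *)
Lemma section_angle (s : R -> R * R) (h c : R) :
  cross_section s -> 0 < h -> on_ray (fst (s h)) (snd (s h)) c ->
  exists sigma d K, 0 < d < h /\ 0 <= K /\ sigma h = c /\
    forall k, Rabs (k - h) <= d ->
      on_ray (fst (s k)) (snd (s k)) (sigma k) /\ continuity_pt sigma k /\
      Rabs (sigma k - c) <= K * Rabs (k - h).
Proof.
  intros Hs Hh [Hc1 Hc2].
  assert (HHam : forall k, 0 < k -> Ham (fst (s k)) (snd (s k)) = k) by (intros; now apply Hs).
  rewrite (HHam h Hh) in Hc1, Hc2.
  set (A := fun k => amp (fst (s k)) * cos c + snd (s k) * sin c).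
  set (B := fun k => snd (s k) * cos c - amp (fst (s k)) * sin c).
  pose proof (sin2_cos2 c) as Hsc; unfold Rsqr in Hsc.
  assert (Hdiff : forall k, 0 < k -> ex_derive A k /\ ex_derive B k).
  { intros k Hk; destruct (Hs k Hk) as (H1 & H2 & _).
    apply analytic_ex_derive in H1; apply analytic_ex_derive in H2.
    assert (H3 : ex_derive (fun k => amp (fst (s k))) k).
    { apply (ex_derive_comp amp (fun k => fst (s k))); [eexists; apply amp_derive | exact H1]. }
    assert (Hcomb : forall (f g : R -> R) a b, ex_derive f k -> ex_derive g k ->
      ex_derive (fun u => f u * a + g u * b) k) by (intros; auto_derive; auto).
    split; [exact (Hcomb _ _ (cos c) (sin c) H3 H2) |].
    apply ex_derive_ext with (fun u => snd (s u) * cos c + amp (fst (s u)) * - sin c).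
    { intros u; apply Rminus_diag_uniq; unfold B; ring. }
    exact (Hcomb _ _ _ _ H2 H3). }
  assert (Hq : 0 < sqrt (2 * h)) by (apply sqrt_lt_R0; lra).
  assert (HAh : A h = sqrt (2 * h)).
  { unfold A; rewrite Hc1, Hc2.
    transitivity (sqrt (2 * h) * (sin c * sin c + cos c * cos c)); [ring | rewrite Hsc; ring]. }
  assert (HBh : B h = 0) by (unfold B; rewrite Hc1, Hc2; ring).
  set (sigma := fun k => c + atan (B k / A k)).
  assert (Hsig : forall k, 0 < k -> 0 < A k -> ex_derive sigma k).
  { intros k Hk HA; destruct (Hdiff k Hk) as [H1 H2].
    unfold sigma; auto_derive; repeat split; auto; lra. }
  assert (Hsh : sigma h = c).
  { unfold sigma; rewrite HBh, Rdiv_0_l, atan_0; ring. }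
  destruct (Hsig h Hh ltac:(lra)) as [ds Hds].
  destruct (pointwise_lipschitz _ _ _ Hds) as (K & r1 & HK & Hr1 & HL).
  destruct (Hdiff h Hh) as [[dA HdA] _].
  destruct (pointwise_lipschitz _ _ _ HdA) as (KA & r2 & HKA & Hr2 & HLA).
  (* The last bound keeps A positive. *)
  set (d := Rmin (h / 2) (Rmin r1 (Rmin r2 (sqrt (2 * h) / (2 * (KA + 1)))))).
  assert (Hd0 : 0 < sqrt (2 * h) / (2 * (KA + 1))) by (apply Rdiv_lt_0_compat; lra).
  assert (Hd : 0 < d <= h / 2 /\ d <= r1 /\ d <= r2 /\ d <= sqrt (2 * h) / (2 * (KA + 1))).
  { unfold d; repeat split.
    - repeat apply Rmin_pos; lra.
    - apply Rmin_l.
    - eapply Rle_trans; [apply Rmin_r | apply Rmin_l].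
    - eapply Rle_trans; [apply Rmin_r |]; eapply Rle_trans; [apply Rmin_r | apply Rmin_l].
    - eapply Rle_trans; [apply Rmin_r |]; eapply Rle_trans; [apply Rmin_r | apply Rmin_r]. }
  exists sigma, d, K; split; [lra | split; [exact HK | split; [exact Hsh |]]].
  intros k Hk.
  assert (Hk0 : 0 < k) by (apply Rabs_le_between in Hk; lra).
  assert (HA : 0 < A k).
  { specialize (HLA k ltac:(lra)); rewrite HAh in HLA.
    assert (Hsm : KA * Rabs (k - h) <= (KA + 1) * (sqrt (2 * h) / (2 * (KA + 1)))).
    { apply Rmult_le_compat; try lra; apply Rabs_pos. }
    replace ((KA + 1) * (sqrt (2 * h) / (2 * (KA + 1)))) with (sqrt (2 * h) / 2) in Hsm by (field; lra).
    apply Rabs_le_between in HLA; lra. }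
  split; [| split].
  - assert (HAB : A k ^ 2 + B k ^ 2 = 2 * k).
    { rewrite <- (HHam k Hk0) at 3; rewrite <- amp_energy.
      unfold A, B.
      transitivity ((amp (fst (s k)) ^ 2 + snd (s k) ^ 2) * (sin c * sin c + cos c * cos c)); [ring |].
      rewrite Hsc; ring. }
    assert (Hqk : 0 < sqrt (2 * k)) by (apply sqrt_lt_R0; lra).
    assert (Hroot : sqrt (1 + (B k / A k) ^ 2) = sqrt (2 * k) / A k).
    { replace (1 + (B k / A k) ^ 2) with ((2 * k) / A k ^ 2) by (rewrite <- HAB; field; lra).
      rewrite sqrt_div by (try apply pow_lt; lra). rewrite sqrt_pow2 by lra; reflexivity. }
    unfold on_ray; rewrite (HHam k Hk0); unfold sigma.
    rewrite cos_plus, sin_plus, cos_atan, sin_atan, Rsqr_pow2, Hroot.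
    split.
    + transitivity (A k * cos c - B k * sin c); [| field; lra].
      unfold A, B.
      transitivity (amp (fst (s k)) * (sin c * sin c + cos c * cos c)); [rewrite Hsc; ring | ring].
    + transitivity (B k * cos c + A k * sin c); [| field; lra].
      unfold A, B.
      transitivity (snd (s k) * (sin c * sin c + cos c * cos c)); [rewrite Hsc; ring | ring].
  - destruct (Hsig k Hk0 HA) as [e He]; now apply is_derive_continuity with e.
  - rewrite <- Hsh; apply HL; lra.
Qed.

Lemma same_ray (q u v : R) :
  0 < q -> q * cos u = q * cos v -> q * sin u = q * sin v ->
  exists j : Z, u - v = 2 * PI * IZR j.
Proof.
  intros Hq Hc Hs.
  apply Rmult_eq_reg_l in Hc; [| lra]; apply Rmult_eq_reg_l in Hs; [| lra].
  assert (H1 : cos (u - v) = 1).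
  { rewrite cos_minus, Hc, Hs. pose proof (sin2_cos2 v); unfold Rsqr in *; lra. }
  assert (H2 : sin ((u - v) / 2) = 0).
  { replace (u - v) with (2 * ((u - v) / 2)) in H1 by field.
    rewrite cos_2a_sin in H1. nra. }
  destruct (sin_eq_0_0 _ H2) as [j Hj]; exists j; lra.
Qed.

Lemma minus_one_turn (d : R) (j : Z) :
  d = 2 * PI * IZR j -> - (2 * PI) <= d < 0 -> d = - (2 * PI).
Proof.
  intros Hd Hb; pose proof PI_RGT_0.
  assert (Hj1 : -1 <= IZR j) by nra.
  assert (Hj2 : IZR j < 0) by nra.
  apply le_IZR in Hj1; apply lt_IZR in Hj2.
  assert (j = (-1)%Z) by lia; subst j; lra.
Qed.

Lemma first_full_turn (G : R -> R) (S : R) :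
  0 < S -> (forall t, 0 <= t <= S -> continuity_pt G t) ->
  G 0 = 0 -> (forall t, 0 < t < S -> G t <> - (2 * PI)) -> - (2 * PI) <= G S.
Proof.
  intros HS Hc H0 Hn; destruct (Rle_lt_dec (- (2 * PI)) (G S)) as [H | H]; [exact H |].
  exfalso; pose proof PI_RGT_0.
  destruct (Ranalysis5.IVT_interv (fun t => - (2 * PI) - G t) 0 S) as [z [Hz Hz0]];
    [| exact HS | lra | lra |].
  - intros t Ht; apply continuity_pt_minus; [apply continuity_pt_const; now intros ? ? | auto].
  - apply (Hn z); [| lra].
    destruct (Req_dec z 0) as [-> | ]; [lra |].
    destruct (Req_dec z S) as [-> | ]; lra.
Qed.

(** The angle of the orbit relative to the section, G, is at most - t / 4,
    so it reaches - 2 PI by time 8 PI; the span 9 PI leaves a margin that shows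
    that the return comes before it. *)
Lemma turn_count (G : R -> R) (T S : R) :
  0 < T -> S = Rmin T (9 * PI) ->
  (forall t, 0 <= t <= S -> continuity_pt G t) ->
  G 0 = 0 -> (forall t, 0 <= t <= S -> G t <= - t / 4) ->
  (forall t, 0 < t < S -> G t <> - (2 * PI)) ->
  (S = T -> exists j : Z, G T = 2 * PI * IZR j) ->
  S = T /\ G T = - (2 * PI).
Proof.
  intros HT HS Hc H0 Hdec Hn Hj; pose proof PI_RGT_0 as Hpi.
  assert (HS0 : 0 < S) by (rewrite HS; apply Rmin_pos; lra).
  pose proof (first_full_turn G S HS0 Hc H0 Hn) as Hge.
  pose proof (Hdec S ltac:(lra)) as Hle.
  assert (HST : S = T).
  { rewrite HS in *; unfold Rmin in *; destruct (Rle_dec T (9 * PI)); lra. }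
  split; [exact HST |].
  destruct (Hj HST) as [j Hjeq]; rewrite HST in Hge, Hle.
  apply minus_one_turn with j; lra.
Qed.

(** By 2 |amp x * y| <= amp^2 + y^2 = 2 H. *)
Lemma angular_speed (l : nat -> R) (x y : R) :
  0 < Ham x y ->
  Rabs (damping l x y * (amp x * y / (2 * Ham x y))) <= Rabs (damping l x y).
Proof.
  intros HH; rewrite Rabs_mult.
  rewrite <- (Rmult_1_r (Rabs (damping l x y))) at 2.
  apply Rmult_le_compat_l; [apply Rabs_pos |].
  pose proof (amp_energy x y) as He.
  pose proof (pow2_ge_0 (amp x - y)); pose proof (pow2_ge_0 (amp x + y)).
  apply Rabs_le; split; apply Rmult_le_reg_r with (2 * Ham x y); try lra;
    unfold Rdiv; rewrite (Rmult_assoc (amp x * y)), Rinv_l by lra; nra.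
Qed.

(** For small parameters the first return is neither premature nor delayed: the
    section angle moves slower than the orbit, so the relative angle is negative and
    reaches - 2 PI first. The return time has no a priori bound: a return later than
    9 PI is excluded by an earlier crossing. *)
Lemma return_is_one_turn (s : R -> R * R) (h d c : R) :
  cross_section s -> 0 < h -> 0 < d -> on_ray (fst (s h)) (snd (s h)) c ->
  exists C s0 K, 0 <= C /\ 0 < s0 /\ 0 <= K /\
    forall l p, param_size l <= s0 -> first_return s l h p ->
    exists T x y phi, 0 < T <= 36 /\ orbit l T x y /\
      (x 0, y 0) = s h /\ (x T, y T) = s p /\ 0 < p /\
      phi 0 = c /\ Rabs (phi T - (c - 2 * PI)) <= K * Rabs (p - h) /\
      forall t, 0 <= t <= T ->
        Rabs (Ham (x t) (y t) - h) <= d /\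
        Rabs (Ham (x t) (y t) - h) <= C * param_size l * t /\
        on_ray (x t) (y t) (phi t) /\
        is_derive phi t
          (- kap (x t) + damping l (x t) (y t) * (amp (x t) * y t / (2 * Ham (x t) (y t)))).
Proof.
  intros Hs Hh Hd Hc.
  destruct (section_angle s h c Hs Hh Hc) as (sigma & r & K & Hr & HK & Hsh & Hsig).
  assert (Hd' : 0 < Rmin d r) by (apply Rmin_pos; lra).
  destruct (energy_close h _ Hh Hd') as (C & s1 & HC & Hs1 & Hclose).
  (* The second bound slows the section angle down to 1/4, the third keeps the
     angular speed of the orbit above 1/2. *)
  set (s0 := Rmin s1 (Rmin (/ (4 * (K * C + 1))) (/ (32 * (1 + 2 * h) ^ 2)))).
  assert (HKC : 0 <= K * C) by (apply Rmult_le_pos; lra).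
  assert (Hh2 : 0 < 32 * (1 + 2 * h) ^ 2) by (apply Rmult_lt_0_compat; [lra | apply pow_lt; lra]).
  exists C, s0, K; split; [exact HC | split; [| split; [exact HK |]]].
  { unfold s0; repeat apply Rmin_pos; try lra; apply Rinv_0_lt_compat; lra. }
  intros l p Hsz (T & x & y & HT & Ho & Hst & Hp & Hend & Hfirst).
  assert (Hsz1 : param_size l <= s1) by (eapply Rle_trans; [exact Hsz | apply Rmin_l]).
  assert (Hsz2 : param_size l <= / (4 * (K * C + 1))).
  { eapply Rle_trans; [exact Hsz |]; eapply Rle_trans; [apply Rmin_r | apply Rmin_l]. }
  assert (Hsz3 : param_size l <= / (32 * (1 + 2 * h) ^ 2)).
  { eapply Rle_trans; [exact Hsz |]; eapply Rle_trans; [apply Rmin_r | apply Rmin_r]. }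
  pose proof (param_size_ge0 l) as Hsz0.
  set (S := Rmin T (9 * PI)).
  pose proof PI_RGT_0 as Hpi; pose proof PI_4 as Hpi4.
  assert (HS : 0 < S <= 36 /\ S <= T).
  { unfold S; split; [split |]; [apply Rmin_pos; lra | | apply Rmin_l].
    eapply Rle_trans; [apply Rmin_r | lra]. }
  assert (HoS : orbit l S x y) by (apply orbit_restrict with T; [lra | exact Ho]).
  assert (Hx0 : x 0 = fst (s h) /\ y 0 = snd (s h)) by (rewrite <- Hst; easy).
  assert (H0 : Ham (x 0) (y 0) = h).
  { destruct Hx0 as [-> ->]; now apply Hs. }
  pose proof (Hclose l S x y Hsz1 ltac:(lra) HoS H0) as Hcl.
  assert (Hcl2 : forall t, 0 <= t <= S -> Rabs (Ham (x t) (y t) - h) <= d /\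
       Rabs (Ham (x t) (y t) - h) <= r).
  { intros t Ht; destruct (Hcl t Ht) as [_ H]; split;
      (eapply Rle_trans; [exact H |]); [apply Rmin_l | apply Rmin_r]. }
  assert (Hpos : forall t, 0 <= t <= S -> 0 < Ham (x t) (y t) <= 2 * h).
  { intros t Ht; destruct (Hcl2 t Ht) as [_ H]; apply Rabs_le_between in H; lra. }
  destruct (polar_orbit l S x y c) as [phi [Hphi0 Hphi]];
    [lra | exact HoS | intros t Ht; now apply Hpos | destruct Hx0 as [-> ->]; exact Hc |].
  assert (Hslow : forall t, 0 <= t <= S -> phi t <= c - t / 2).
  { intros t Ht.
    assert (Hm : c - phi 0 - 0 / 2 <= c - phi t - t / 2).
    { apply (monotone_of_derive (fun u => c - phi u - u / 2)
        (fun u => - (- kap (x u) + damping l (x u) (y u)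
               * (amp (x u) * y u / (2 * Ham (x u) (y u)))) - / 2)); [lra | |].
      - intros u Hu; destruct (Hphi u ltac:(lra)) as [_ Hdu].
        set (wu := _ + _) in Hdu |- *.
        auto_derive; [now exists wu |].
        rewrite (Derive_eq _ _ _ Hdu); field.
      - intros u Hu. pose proof (kap_ge_1 (x u)).
        destruct (Hpos u ltac:(lra)) as [Hp1 Hp2].
        pose proof (angular_speed l (x u) (y u) Hp1) as Ha.
        pose proof (damping_bound l (x u) (y u)) as Hb.
        assert (8 * (1 + Ham (x u) (y u)) ^ 2 * param_size l <= / 2).
        { apply Rle_trans with (8 * (1 + 2 * h) ^ 2 * / (32 * (1 + 2 * h) ^ 2)).
          - apply Rmult_le_compat; [| lra | | lra].
            + apply Rmult_le_pos; [lra | apply pow2_ge_0].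
            + apply Rmult_le_compat_l; [lra |]; apply pow_incr; lra.
          - apply Rle_trans with (/ 4); [| lra]. apply Req_le; field. lra. }
        apply Rabs_le_between in Ha; lra. }
    rewrite Hphi0 in Hm; lra. }
  set (G := fun t => phi t - sigma (Ham (x t) (y t))).
  assert (Hdrift : forall t, 0 <= t <= S -> G t <= - t / 4).
  { intros t Ht; specialize (Hslow t Ht); destruct (Hcl t Ht) as [Hc1 _].
    destruct (Hcl2 t Ht) as [_ Hc2]; destruct (Hsig _ Hc2) as (_ & _ & Hc3).
    assert (HKt : K * Rabs (Ham (x t) (y t) - h) <= t / 4).
    { apply Rle_trans with (K * (C * param_size l * t)); [now apply Rmult_le_compat_l |].
      replace (K * (C * param_size l * t)) with ((K * C * param_size l) * t) by ring.
      replace (t / 4) with (/ 4 * t) by field.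
      apply Rmult_le_compat_r; [lra |].
      apply Rle_trans with ((K * C + 1) * / (4 * (K * C + 1))).
      - apply Rmult_le_compat; lra.
      - apply Req_le; field; lra. }
    apply Rabs_le_between in Hc3; unfold G; lra. }
  destruct (turn_count G T S HT eq_refl) as [HST HGT].
  - intros t Ht; apply continuity_pt_minus.
    + destruct (Hphi t Ht) as [_ H]; now apply is_derive_continuity with (1 := H).
    + apply (continuity_pt_comp (fun t => Ham (x t) (y t)) sigma).
      * apply is_derive_continuity with (1 := orbit_energy_derive l S x y t HoS Ht).
      * apply Hsig, Hcl2, Ht.
  - unfold G; rewrite H0, Hphi0, Hsh; ring.
  - exact Hdrift.
  - intros t Ht HG.
    assert (Ht' : 0 <= t <= S) by lra.
    destruct (Hcl2 t Ht') as [_ Hc2].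
    destruct (Hpos t Ht') as [Hp1 _].
    apply (Hfirst t (Ham (x t) (y t))); [lra | exact Hp1 |].
    destruct (Hsig _ Hc2) as (Hray & _).
    destruct (Hphi t Ht') as [Hray' _].
    rewrite (surjective_pairing (s (Ham (x t) (y t)))).
    apply on_ray_inj with (sigma (Ham (x t) (y t))); [| exact Hray |].
    + unfold G in HG. replace (sigma (Ham (x t) (y t))) with (phi t + 2 * PI) by lra.
      destruct Hray' as [Hr1 Hr2]; split;
        [rewrite Hr1 at 1; f_equal | rewrite Hr2 at 1; f_equal].
      * rewrite cos_plus, cos_2PI, sin_2PI; ring.
      * rewrite sin_plus, cos_2PI, sin_2PI; ring.
    + symmetry; now apply Hs.
  - intros HST.
    assert (Ht' : 0 <= T <= S) by lra.
    destruct (Hcl2 T Ht') as [_ Hc2]; destruct (Hpos T Ht') as [Hp1 _].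
    destruct (Hphi T Ht') as [[Hr1 Hr2] _].
    assert (Hxp : x T = fst (s p) /\ y T = snd (s p)) by (rewrite <- Hend; easy).
    assert (HTp : Ham (x T) (y T) = p) by (destruct Hxp as [-> ->]; now apply Hs).
    destruct (Hsig _ Hc2) as ([Hr3 Hr4] & _).
    rewrite HTp in *. destruct Hxp as [Hxp Hyp].
    rewrite <- Hxp, <- Hyp, HTp in Hr3, Hr4.
    unfold G; rewrite HTp.
    apply same_ray with (sqrt (2 * p)); [apply sqrt_lt_R0; lra | lra | lra].
  - rewrite HST in *. assert (Ht' : 0 <= T <= T) by lra.
    exists T, x, y, phi; repeat (split; [first [assumption | lra] |]).
    destruct (Hcl2 T Ht') as [_ Hc2].
    assert (HTp : Ham (x T) (y T) = p).
    { assert (Hxp : x T = fst (s p) /\ y T = snd (s p)) by (rewrite <- Hend; easy).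
      destruct Hxp as [-> ->]; now apply Hs. }
    split.
    + destruct (Hsig _ Hc2) as (_ & _ & H3). unfold G in HGT; rewrite HTp in *.
      replace (phi T - (c - 2 * PI)) with (sigma p - c) by lra. exact H3.
    + intros t Ht; destruct (Hcl2 t Ht); destruct (Hcl t Ht); destruct (Hphi t Ht); auto.
Qed.

(** * Oval integrals as integrals over the angle *)

(** On the free flow dt = - dphi / kap, so x^i y^2 dt = - profile dphi. *)
Definition angular_density (i : nat) (X : R) : R := amp_inv X ^ i / kap (amp_inv X).
Definition profile (i : nat) (h phi : R) : R :=
  angular_density i (sqrt (2 * h) * cos phi) * (sqrt (2 * h) * sin phi) ^ 2.

Lemma amp_inv_ex_derive (X : R) : ex_derive amp_inv X.
Proof.
  pose proof (pow2_ge_0 X).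
  assert (0 <= sqrt (1 + 2 * X ^ 2)) by apply sqrt_pos.
  unfold amp_inv; auto_derive; simpl in *; repeat split; try lra.
  apply Rgt_not_eq, sqrt_lt_R0; lra.
Qed.

Lemma amp_inv_bound (X : R) : Rabs (amp_inv X) <= Rabs X.
Proof.
  assert (H1 : 1 <= sqrt (1 + 2 * X ^ 2)).
  { rewrite <- sqrt_1 at 1; apply sqrt_le_1_alt; pose proof (pow2_ge_0 X); lra. }
  assert (H2 : sqrt 2 <= sqrt (1 + sqrt (1 + 2 * X ^ 2))) by (apply sqrt_le_1_alt; lra).
  assert (H3 : 0 < sqrt 2) by (apply sqrt_lt_R0; lra).
  unfold amp_inv, Rdiv; rewrite !Rabs_mult, Rabs_inv, (Rabs_pos_eq (sqrt 2)),
    (Rabs_pos_eq (sqrt (1 + _))) by lra.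
  apply Rmult_le_reg_r with (sqrt (1 + sqrt (1 + 2 * X ^ 2))); [lra |].
  rewrite Rmult_assoc, Rinv_l, Rmult_1_r by lra.
  apply Rmult_le_compat_l; [apply Rabs_pos | exact H2].
Qed.

Lemma kap_ex_derive (x : R) : ex_derive kap x.
Proof.
  pose proof (half_square_pos x).
  unfold kap; auto_derive; simpl in *; repeat split; try lra.
  apply Rgt_not_eq, sqrt_lt_R0; lra.
Qed.

Lemma angular_density_ex_derive (i : nat) (X : R) : ex_derive (angular_density i) X.
Proof.
  pose proof (kap_ge_1 (amp_inv X)).
  assert (Hk : ex_derive (fun u => kap (amp_inv u)) X)
    by (apply (ex_derive_comp kap amp_inv); [apply kap_ex_derive | apply amp_inv_ex_derive]).
  apply (ex_derive_div (fun u => amp_inv u ^ i) (fun u => kap (amp_inv u))); [| exact Hk | lra].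
  apply ex_derive_pow, amp_inv_ex_derive.
Qed.

Lemma angular_density_bound (i : nat) (X A : R) :
  Rabs X <= A -> Rabs (angular_density i X) <= A ^ i.
Proof.
  intros HX; pose proof (kap_ge_1 (amp_inv X)); pose proof (amp_inv_bound X).
  unfold angular_density, Rdiv; rewrite Rabs_mult, Rabs_inv, (Rabs_pos_eq (kap _)), <- RPow_abs by lra.
  rewrite <- (Rmult_1_r (A ^ i)).
  apply Rmult_le_compat.
  - apply pow_le, Rabs_pos.
  - left; apply Rinv_0_lt_compat; lra.
  - apply pow_incr; split; [apply Rabs_pos | lra].
  - rewrite <- Rinv_1; apply Rinv_le_contravar; lra.
Qed.

Lemma profile_continuous (i : nat) (h phi : R) : continuous (profile i h) phi.
Proof.
  apply (ex_derive_continuous (V := R_NormedModule)).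
  apply (ex_derive_mult (fun u => angular_density i (sqrt (2 * h) * cos u))
           (fun u => (sqrt (2 * h) * sin u) ^ 2)).
  - apply (ex_derive_comp (angular_density i) (fun u => sqrt (2 * h) * cos u)).
    + apply angular_density_ex_derive.
    + auto_derive; trivial.
  - auto_derive; trivial.
Qed.

Lemma profile_on_ray (i : nat) (x y phi : R) :
  on_ray x y phi -> x ^ i * y ^ 2 = profile i (Ham x y) phi * kap x.
Proof.
  intros [H1 H2]; unfold profile, angular_density.
  rewrite <- H1, <- H2, ampK; pose proof (kap_ge_1 x); field; lra.
Qed.

Definition sweep (i : nat) (h phi : R) : R := RInt (profile i h) 0 phi.
Definition period_integral (i : nat) (h : R) : R := sweep i h (2 * PI).

Lemma sweep_derive (i : nat) (h phi : R) : is_derive (sweep i h) phi (profile i h phi).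
Proof.
  apply (is_derive_RInt (profile i h) (sweep i h) 0); [| apply profile_continuous].
  apply filter_forall; intros b.
  apply (RInt_correct (V := R_CompleteNormedModule)),
    (ex_RInt_continuous (V := R_CompleteNormedModule)).
  intros; apply profile_continuous.
Qed.

(** [profile] is 2 PI periodic, so the starting angle is immaterial. *)
Lemma sweep_turn (i : nat) (h a : R) :
  sweep i h a - sweep i h (a - 2 * PI) = period_integral i h.
Proof.
  assert (Hd : forall t, is_derive (fun u => sweep i h u - sweep i h (u - 2 * PI)) t 0).
  { intros t.
    assert (H2 : is_derive (fun u => sweep i h (u - 2 * PI)) t (profile i h t)).
    { apply (is_derive_value _ _ (scal 1 (profile i h (t - 2 * PI)))).
      - apply (is_derive_comp (sweep i h) (fun u => u - 2 * PI)); [apply sweep_derive |].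
        auto_derive; [trivial | ring].
      - unfold scal; simpl; unfold mult; simpl; unfold profile.
        replace (cos (t - 2 * PI)) with (cos t)
          by (rewrite cos_minus, cos_2PI, sin_2PI; ring).
        replace (sin (t - 2 * PI)) with (sin t)
          by (rewrite sin_minus, cos_2PI, sin_2PI; ring).
        ring. }
    apply (is_derive_value _ _ _ _ (is_derive_minus _ _ _ _ _ (sweep_derive i h t) H2)).
    unfold minus, plus, opp; simpl; ring. }
  assert (Hc : forall u v, u <= v -> sweep i h v - sweep i h (v - 2 * PI)
                                   = sweep i h u - sweep i h (u - 2 * PI)).
  { intros u v Huv.
    pose proof (mean_value_bound _ (fun _ => 0) u v 0 Huv (fun t _ => Hd t)
      (fun t _ => Req_le _ _ Rabs_R0)) as H.
    cbv beta in H. apply Rabs_le_between in H; lra. }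
  transitivity (sweep i h (2 * PI) - sweep i h (2 * PI - 2 * PI)).
  - destruct (Rle_lt_dec a (2 * PI)); [symmetry |]; apply Hc; lra.
  - replace (2 * PI - 2 * PI) with 0 by ring.
    unfold period_integral, sweep at 2; rewrite RInt_point; unfold zero; simpl; ring.
Qed.

(** Along a slightly perturbed orbit, with f the perturbation of the angular speed,
    x^i y^2 is close to minus the derivative of [sweep] at the fixed level h. This
    replaces the convergence of the perturbed orbits to the oval. *)
Lemma level_quadrature (i : nat) (h eta : R) :
  0 < h -> 0 < eta ->
  exists d, 0 < d /\ forall x y phi f,
    on_ray x y phi -> Rabs (Ham x y - h) <= d -> Rabs f <= d ->
    Rabs (x ^ i * y ^ 2 + profile i h phi * (- kap x + f)) <= eta.
Proof.
  intros Hh Heta.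
  set (A := 2 * h + 1).
  assert (Hunif : uniform_continuity (angular_density i) (fun X => - A <= X <= A)).
  { apply Heine; [apply compact_P3 |].
    intros X _; destruct (angular_density_ex_derive i X) as [e He].
    now apply is_derive_continuity with e. }
  set (V := A ^ i).
  assert (HV : 1 <= V) by (apply pow_R1_Rle; unfold A; lra).
  set (e1 := eta / (8 * (h + 1) * (4 * h + 1))).
  assert (He1 : 0 < e1) by (apply Rdiv_lt_0_compat; [lra | apply Rmult_lt_0_compat; lra]).
  destruct (Hunif (mkposreal e1 He1)) as [r Hr]; simpl in Hr; pose proof (cond_pos r) as Hr0.
  assert (Hq0 : 0 < sqrt (2 * h)) by (apply sqrt_lt_R0; lra).
  set (d := Rmin h (Rmin (sqrt (2 * h) * r / 4) (eta / (16 * V * (h + 1) * (4 * h + 1))))).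
  assert (HVp : 0 < 16 * V * (h + 1) * (4 * h + 1))
    by (repeat apply Rmult_lt_0_compat; lra).
  assert (Hd : 0 < d /\ d <= h /\ d <= sqrt (2 * h) * r / 4
               /\ d <= eta / (16 * V * (h + 1) * (4 * h + 1))).
  { unfold d; repeat split.
    - repeat apply Rmin_pos; [lra | | apply Rdiv_lt_0_compat; lra].
      pose proof (Rmult_lt_0_compat _ _ Hq0 Hr0); lra.
    - apply Rmin_l.
    - eapply Rle_trans; [apply Rmin_r | apply Rmin_l].
    - eapply Rle_trans; [apply Rmin_r | apply Rmin_r]. }
  clearbody d; destruct Hd as (Hd & Hd1 & Hd2 & Hd3).
  exists d; split; [exact Hd |].
  intros x y phi f Hray HE Hf.
  rewrite (profile_on_ray i x y phi Hray).
  set (E := Ham x y) in *.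
  assert (HE2 : 0 <= E <= 2 * h) by (apply Rabs_le_between in HE; lra).
  assert (Hk : 1 <= kap x <= 4 * h + 1).
  { split; [apply kap_ge_1 |].
    destruct (ham_coordinates x y) as (_ & Hx & _); change (Ham x y) with E in Hx.
    assert (H1 : 1 <= sqrt (1 + x ^ 2 / 2)).
    { rewrite <- sqrt_1 at 1; apply sqrt_le_1_alt; pose proof (pow2_ge_0 x); lra. }
    unfold kap; apply Rmult_le_reg_r with (sqrt (1 + x ^ 2 / 2)); [lra |].
    unfold Rdiv at 1; rewrite Rmult_assoc, Rinv_l by lra.
    pose proof (pow2_ge_0 x); nra. }
  set (q := sqrt (2 * E)); set (q0 := sqrt (2 * h)) in *.
  assert (Hq : 0 <= q) by apply sqrt_pos.
  assert (Hqs : q ^ 2 = 2 * E) by (apply sqrt_sq; lra).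
  assert (Hq0s : q0 ^ 2 = 2 * h) by (apply sqrt_sq; lra).
  assert (HqA : q <= A /\ q0 <= A) by (unfold A; split; nra).
  assert (Hdq : Rabs (q - q0) * q0 <= 2 * d).
  { apply Rle_trans with (Rabs (q - q0) * (q + q0)).
    - apply Rmult_le_compat_l; [apply Rabs_pos | lra].
    - rewrite <- (Rabs_pos_eq (q + q0)) by lra; rewrite <- Rabs_mult.
      replace ((q - q0) * (q + q0)) with (2 * (E - h)) by (rewrite Rmult_comm; nra).
      rewrite Rabs_mult, (Rabs_pos_eq 2) by lra; lra. }
  assert (Hdqr : Rabs (q - q0) < r).
  { apply Rmult_lt_reg_r with q0; [exact Hq0 |].
    pose proof (Rmult_lt_0_compat _ _ Hq0 Hr0); lra. }
  pose proof (COS_bound phi) as Hcb.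
  assert (Hcos : Rabs (cos phi) <= 1) by (apply Rabs_le; lra).
  assert (Hin : forall u, 0 <= u <= A -> Rabs (u * cos phi) <= A).
  { intros u Hu; rewrite Rabs_mult, (Rabs_pos_eq u) by lra.
    pose proof (Rabs_pos (cos phi)); nra. }
  assert (Hin1 := Hin q ltac:(lra)); assert (Hin0 := Hin q0 ltac:(lra)).
  assert (Hv : Rabs (angular_density i (q * cos phi) - angular_density i (q0 * cos phi)) <= e1).
  { left; apply Hr; [now apply Rabs_le_between in Hin1 | now apply Rabs_le_between in Hin0 |].
    replace (q * cos phi - q0 * cos phi) with ((q - q0) * cos phi) by ring.
    rewrite Rabs_mult; pose proof (Rabs_pos (cos phi)); pose proof (Rabs_pos (q - q0)); nra. }
  assert (Hv0 : Rabs (angular_density i (q0 * cos phi)) <= V)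
    by now apply angular_density_bound.
  pose proof (SIN_bound phi) as Hsb.
  assert (Hsin : 0 <= sin phi ^ 2 <= 1) by (split; [apply pow2_ge_0 | nra]).
  assert (Hdiff : Rabs (profile i E phi - profile i h phi) <= e1 * (4 * h) + V * (2 * d)).
  { unfold profile; fold q q0.
    replace (angular_density i (q * cos phi) * (q * sin phi) ^ 2
             - angular_density i (q0 * cos phi) * (q0 * sin phi) ^ 2)
      with ((angular_density i (q * cos phi) - angular_density i (q0 * cos phi))
             * (q ^ 2 * sin phi ^ 2)
            + angular_density i (q0 * cos phi) * ((q ^ 2 - q0 ^ 2) * sin phi ^ 2)) by ring.
    rewrite Hqs, Hq0s.
    eapply Rle_trans; [apply Rabs_triang |]; apply Rplus_le_compat; rewrite Rabs_mult.
    - apply Rmult_le_compat; [apply Rabs_pos | apply Rabs_pos | exact Hv |].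
      rewrite Rabs_pos_eq; nra.
    - apply Rmult_le_compat; [apply Rabs_pos | apply Rabs_pos | exact Hv0 |].
      replace (2 * E - 2 * h) with (2 * (E - h)) by ring.
      rewrite !Rabs_mult, (Rabs_pos_eq 2), (Rabs_pos_eq (sin phi ^ 2)) by lra.
      pose proof (Rabs_pos (E - h)); nra. }
  assert (Hprof : Rabs (profile i h phi) <= V * (2 * h)).
  { unfold profile; fold q0; rewrite Rabs_mult.
    apply Rmult_le_compat; [apply Rabs_pos | apply Rabs_pos | exact Hv0 |].
    rewrite Rpow_mult_distr, Hq0s, Rabs_pos_eq; nra. }
  replace (profile i E phi * kap x + profile i h phi * (- kap x + f))
    with ((profile i E phi - profile i h phi) * kap x + profile i h phi * f) by ring.
  eapply Rle_trans; [apply Rabs_triang |]; rewrite !Rabs_mult, (Rabs_pos_eq (kap x)) by lra.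
  apply Rle_trans with ((e1 * (4 * h) + V * (2 * d)) * (4 * h + 1) + V * (2 * h) * d).
  { apply Rplus_le_compat; apply Rmult_le_compat; try apply Rabs_pos; lra. }
  assert (Ht1 : e1 * (4 * h) * (4 * h + 1) <= eta / 2).
  { apply Rle_trans with (e1 * (4 * (h + 1)) * (4 * h + 1)).
    - apply Rmult_le_compat_r; [lra |]; apply Rmult_le_compat_l; lra.
    - apply Req_le; unfold e1; field; lra. }
  assert (Ht2 : V * (2 * d) * (4 * h + 1) + V * (2 * h) * d <= eta / 2).
  { apply Rle_trans with (8 * V * (h + 1) * (4 * h + 1) * d).
    - assert (0 <= V * d) by (apply Rmult_le_pos; lra).
      replace (V * (2 * d) * (4 * h + 1) + V * (2 * h) * d)
        with ((V * d) * (2 * (4 * h + 1) + 2 * h)) by ring.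
      replace (8 * V * (h + 1) * (4 * h + 1) * d)
        with ((V * d) * (8 * (h + 1) * (4 * h + 1))) by ring.
      apply Rmult_le_compat_l; [assumption | nra].
    - apply Rle_trans with (8 * V * (h + 1) * (4 * h + 1)
          * (eta / (16 * V * (h + 1) * (4 * h + 1)))).
      + apply Rmult_le_compat_l; lra.
      + apply Req_le; field; lra. }
  lra.
Qed.

Lemma damping_zero (l : nat -> R) (x y : R) :
  (forall j, (1 <= j <= 6)%nat -> l j = 0) -> damping l x y = 0.
Proof.
  intros H; unfold damping.
  rewrite (H 1%nat), (H 2%nat), (H 3%nat), (H 4%nat), (H 5%nat), (H 6%nat) by lia; ring.
Qed.

Lemma free_orbit_energy (l : nat -> R) (T : R) (x y : R -> R) (t : R) :
  (forall j, (1 <= j <= 6)%nat -> l j = 0) -> orbit l T x y -> 0 <= t <= T ->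
  Ham (x t) (y t) = Ham (x 0) (y 0).
Proof.
  intros Hl Ho Ht.
  assert (H : Rabs (Ham (x t) (y t) - Ham (x 0) (y 0)) <= 0 * (t - 0)).
  { apply (mean_value_bound (fun u => Ham (x u) (y u)) (fun u => damping l (x u) (y u) * y u ^ 2));
      [lra | |]; intros u Hu.
    - apply (orbit_energy_derive l T); [exact Ho | lra].
    - rewrite damping_zero, Rmult_0_l, Rabs_R0 by exact Hl; lra. }
  rewrite Rmult_0_l in H; apply Rabs_le_between in H; lra.
Qed.

Lemma free_orbit_angle (l : nat -> R) (T h : R) (x y : R -> R) :
  (forall j, (1 <= j <= 6)%nat -> l j = 0) -> 0 < h -> 0 < T -> orbit l T x y ->
  Ham (x 0) (y 0) = h ->
  exists phi, forall t, 0 <= t <= T ->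
    on_ray (x t) (y t) (phi t) /\ is_derive phi t (- kap (x t)) /\ phi t <= phi 0 - t.
Proof.
  intros Hl Hh HT Ho H0.
  destruct (on_ray_exists (x 0) (y 0) ltac:(lra)) as [c Hc].
  destruct (polar_orbit l T x y c) as [phi [Hphi0 Hphi]]; [lra | exact Ho | | exact Hc |].
  { intros t Ht; rewrite (free_orbit_energy l T x y t Hl Ho Ht); lra. }
  assert (Hd : forall t, 0 <= t <= T -> is_derive phi t (- kap (x t))).
  { intros t Ht; destruct (Hphi t Ht) as [_ H].
    rewrite damping_zero in H by exact Hl.
    apply (is_derive_value _ _ _ _ H); ring. }
  exists phi; intros t Ht; split; [now apply Hphi | split; [now apply Hd |]].
  assert (Hm : - phi 0 - 0 <= - phi t - t).
  { apply (monotone_of_derive (fun u => - phi u - u) (fun u => kap (x u) - 1)); [lra | |];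
      intros u Hu.
    - assert (Hdu := Hd u ltac:(lra)); auto_derive; [now exists (- kap (x u)) |].
      rewrite (Derive_eq _ _ _ Hdu); ring.
    - pose proof (kap_ge_1 (x u)); lra. }
  lra.
Qed.

Lemma free_sweep_derive (i : nat) (l : nat -> R) (T h : R) (x y phi : R -> R) (t : R) :
  (forall j, (1 <= j <= 6)%nat -> l j = 0) -> orbit l T x y ->
  Ham (x 0) (y 0) = h -> 0 <= t <= T ->
  on_ray (x t) (y t) (phi t) -> is_derive phi t (- kap (x t)) ->
  is_derive (fun u => - sweep i h (phi u)) t (x t ^ i * y t ^ 2).
Proof.
  intros Hl Ho H0 Ht Hray Hd.
  rewrite (profile_on_ray i _ _ _ Hray), (free_orbit_energy l T x y t Hl Ho Ht), H0.
  apply (is_derive_value _ _ _ _ (is_derive_opp _ _ _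
    (is_derive_comp (sweep i h) phi t _ _ (sweep_derive i h (phi t)) Hd))).
  unfold opp, scal; simpl; unfold mult; simpl; ring.
Qed.

Lemma free_orbit_RInt (i : nat) (F : R -> R -> R) (T h : R) (x y phi : R -> R) :
  (forall u v, F u v = u ^ i * v) -> 0 < T -> orbit (fun _ => 0) T x y ->
  Ham (x 0) (y 0) = h ->
  (forall t, 0 <= t <= T -> on_ray (x t) (y t) (phi t) /\ is_derive phi t (- kap (x t))) ->
  is_RInt (fun t => F (x t) (y t) * Derive x t) 0 T (sweep i h (phi 0) - sweep i h (phi T)).
Proof.
  intros HF HT Ho H0 Hphi.
  apply is_RInt_ext with (fun t => x t ^ i * y t ^ 2).
  { rewrite Rmin_left, Rmax_right by lra; intros t Ht.
    destruct (orbit_velocity _ _ _ _ t Ho ltac:(lra)) as [Hx _].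
    rewrite (is_derive_unique x _ _ Hx : Derive x t = _), HF.
    simpl; apply Rminus_diag_uniq; ring. }
  replace (sweep i h (phi 0) - sweep i h (phi T))
    with (minus (- sweep i h (phi T)) (- sweep i h (phi 0)))
    by (unfold minus, plus, opp; simpl; ring).
  apply (is_RInt_derive (fun t => - sweep i h (phi t)) (fun t => x t ^ i * y t ^ 2));
    rewrite Rmin_left, Rmax_right by lra; intros t Ht.
  - apply (free_sweep_derive i (fun _ => 0) T); auto; now apply Hphi.
  - destruct (orbit_velocity _ _ _ _ t Ho Ht) as [Hx Hy].
    apply (ex_derive_continuous (V := R_NormedModule)); auto_derive.
    repeat split; eexists; eassumption.
Qed.

Lemma closed_orbit_turn (T h : R) (x y phi : R -> R) :
  0 < T -> 0 < h -> orbit (fun _ => 0) T x y -> Ham (x 0) (y 0) = h ->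
  (x T, y T) = (x 0, y 0) ->
  (forall t, 0 < t < T -> (x t, y t) <> (x 0, y 0)) ->
  (forall t, 0 <= t <= T -> on_ray (x t) (y t) (phi t) /\ is_derive phi t (- kap (x t))
                            /\ phi t <= phi 0 - t) ->
  phi T = phi 0 - 2 * PI.
Proof.
  intros HT Hh Ho H0 Hclose Hmin Hphi; pose proof PI_RGT_0.
  assert (HE : forall t, 0 <= t <= T -> Ham (x t) (y t) = h).
  { intros t Ht; rewrite <- H0; now apply (free_orbit_energy (fun _ => 0) T). }
  assert (Hge : - (2 * PI) <= phi T - phi 0).
  { apply (first_full_turn (fun t => phi t - phi 0)); [exact HT | | ring |].
    - intros t Ht; apply continuity_pt_minus; [| apply continuity_pt_const; now intros ? ?].
      apply is_derive_continuity with (- kap (x t)); now apply Hphi.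
    - intros t Ht Heq; apply (Hmin t Ht).
      apply on_ray_inj with (phi 0).
      + destruct (Hphi t ltac:(lra)) as [[H1 H2] _].
        replace (phi 0) with (phi t + 2 * PI) by lra.
        split; [rewrite H1 at 1 | rewrite H2 at 1]; f_equal.
        * rewrite cos_plus, cos_2PI, sin_2PI; ring.
        * rewrite sin_plus, cos_2PI, sin_2PI; ring.
      + apply Hphi; lra.
      + rewrite (HE t), H0; lra. }
  destruct (Hphi T ltac:(lra)) as [[H1 H2] [_ Hle]].
  destruct (Hphi 0 ltac:(lra)) as [[H3 H4] _].
  injection Hclose as Hx Hy; rewrite Hx, Hy, H0 in H1, H2; rewrite H0 in H3, H4.
  destruct (same_ray (sqrt (2 * h)) (phi T) (phi 0)) as [j Hj];
    [apply sqrt_lt_R0; lra | lra | lra |].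
  assert (phi T - phi 0 = - (2 * PI)) by (apply minus_one_turn with j; lra); lra.
Qed.

(** The angle makes uniqueness a change of variables: any closed orbit on the level,
    followed for its minimal period, turns exactly once. *)
Lemma oval_integral_unique (i : nat) (F : R -> R -> R) (h I : R) :
  (forall u v, F u v = u ^ i * v) -> 0 < h ->
  is_oval_integral F h I -> I = period_integral i h.
Proof.
  intros HF Hh (T & x & y & HT & Ho & H0 & Hclose & Hmin & HI).
  destruct (free_orbit_angle (fun _ => 0) T h x y) as [phi Hphi]; auto.
  pose proof (closed_orbit_turn T h x y phi HT Hh Ho H0 Hclose Hmin Hphi) as Hturn.
  assert (HI' := free_orbit_RInt i F T h x y phi HF HT Ho H0
     (fun t Ht => conj (proj1 (Hphi t Ht)) (proj1 (proj2 (Hphi t Ht))))).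
  apply (is_RInt_unique (V := R_CompleteNormedModule)) in HI.
  apply (is_RInt_unique (V := R_CompleteNormedModule)) in HI'.
  rewrite <- HI, HI', Hturn; apply sweep_turn.
Qed.

(** Without damping the return value is h itself, so the returning orbit is closed,
    and first return means minimal period. *)
Lemma closed_oval (s : R -> R * R) (l : nat -> R) (h p : R) :
  (forall j, (1 <= j <= 6)%nat -> l j = 0) -> cross_section s -> 0 < h ->
  first_return s l h p ->
  exists T x y, 0 < T /\ orbit (fun _ => 0) T x y /\ Ham (x 0) (y 0) = h /\
    (x T, y T) = (x 0, y 0) /\
    (forall t, 0 < t < T -> (x t, y t) <> (x 0, y 0)).
Proof.
  intros Hl Hs Hh (T & x & y & HT & Ho & H0 & Hp & Hend & Hfirst).
  exists T, x, y.
  assert (Hx : Ham (x 0) (y 0) = h).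
  { destruct (Hs h Hh) as (_ & _ & He); rewrite <- H0 in He; exact He. }
  assert (HxT : Ham (x T) (y T) = p).
  { destruct (Hs p Hp) as (_ & _ & He); rewrite <- Hend in He; exact He. }
  assert (Hph : p = h).
  { rewrite <- HxT, <- Hx; apply (free_orbit_energy l T); auto; lra. }
  split; [exact HT | split; [| split; [exact Hx | split]]].
  - intros t Ht; destruct (Ho t Ht) as [Hdx Hdy]; split; [exact Hdx |].
    rewrite damping_zero in Hdy by exact Hl.
    rewrite damping_zero by auto; exact Hdy.
  - now rewrite Hend, H0, Hph.
  - intros t Ht; rewrite H0; now apply Hfirst.
Qed.

Lemma oval_integral_value (s : R -> R * R) (l : nat -> R) (i : nat) (F : R -> R -> R) (h p : R) :
  (forall j, (1 <= j <= 6)%nat -> l j = 0) -> cross_section s -> 0 < h ->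
  first_return s l h p ->
  (forall u v, F u v = u ^ i * v) -> oval_integral F h = period_integral i h.
Proof.
  intros Hl Hs Hh Hr HF.
  apply (iota_unique (V := R_CompleteNormedModule)).
  - intros I HI; now apply oval_integral_unique with F.
  - destruct (closed_oval s l h p Hl Hs Hh Hr) as (T & x & y & HT & Ho & H0 & Hc & Hm).
    exists T, x, y; repeat (split; [assumption |]).
    destruct (free_orbit_angle (fun _ => 0) T h x y) as [phi Hphi]; auto.
    rewrite <- (sweep_turn i h (phi 0)),
      <- (closed_orbit_turn T h x y phi HT Hh Ho H0 Hc Hm Hphi).
    apply free_orbit_RInt; auto.
    intros t Ht; destruct (Hphi t Ht) as (H1 & H2 & _); auto.
Qed.

Lemma Rle_Rmin4 (u a b c d : R) :
  u <= Rmin (Rmin a b) (Rmin c d) -> u <= a /\ u <= b /\ u <= c /\ u <= d.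
Proof.
  intros H; pose proof (Rmin_l (Rmin a b) (Rmin c d)); pose proof (Rmin_r (Rmin a b) (Rmin c d)).
  pose proof (Rmin_l a b); pose proof (Rmin_r a b); pose proof (Rmin_l c d); pose proof (Rmin_r c d).
  lra.
Qed.

(** * The displacement over one turn *)

Lemma profile_bound (i : nat) (h phi : R) :
  0 < h -> Rabs (profile i h phi) <= sqrt (2 * h) ^ i * (2 * h).
Proof.
  intros Hh; unfold profile.
  assert (Hq : 0 < sqrt (2 * h)) by (apply sqrt_lt_R0; lra).
  assert (Hqs : sqrt (2 * h) ^ 2 = 2 * h) by (apply sqrt_sq; lra).
  pose proof (COS_bound phi); pose proof (SIN_bound phi).
  rewrite Rabs_mult; apply Rmult_le_compat; [apply Rabs_pos | apply Rabs_pos | |].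
  - apply angular_density_bound; apply Rabs_le; nra.
  - rewrite Rpow_mult_distr, Hqs.
    assert (0 <= sin phi ^ 2 <= 1) by (split; [apply pow2_ge_0 | nra]).
    rewrite Rabs_pos_eq; nra.
Qed.

Lemma sweep_lipschitz (i : nat) (h a b : R) :
  0 < h ->
  Rabs (sweep i h a - sweep i h b) <= sqrt (2 * h) ^ i * (2 * h) * Rabs (a - b).
Proof.
  intros Hh.
  assert (Hord : forall u v, u <= v -> Rabs (sweep i h v - sweep i h u)
      <= sqrt (2 * h) ^ i * (2 * h) * (v - u)).
  { intros u v Huv; apply mean_value_bound with (profile i h); [exact Huv | |].
    - intros; apply sweep_derive.
    - intros; now apply profile_bound. }
  destruct (Rle_lt_dec a b) as [H | H].
  - rewrite (Rabs_minus_sym (sweep i h a)), (Rabs_minus_sym a), (Rabs_pos_eq (b - a)) by lra.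
    now apply Hord.
  - rewrite (Rabs_pos_eq (a - b)) by lra; apply Hord; lra.
Qed.

Lemma section_lipschitz (s : R -> R * R) (h : R) (ps : list bipoly) :
  cross_section s -> 0 < h ->
  exists K r, 0 <= K /\ 0 < r /\ forall k, Rabs (k - h) <= r ->
    List.Forall (fun p => Rabs (ev p (fst (s k)) (snd (s k))
                               - ev p (fst (s h)) (snd (s h))) <= K * Rabs (k - h)) ps.
Proof.
  intros Hs Hh; destruct (Hs h Hh) as (H1 & H2 & _).
  apply analytic_ex_derive in H1; destruct H1 as [dx Hdx].
  apply analytic_ex_derive in H2; destruct H2 as [dy Hdy].
  induction ps as [ | p ps (K & r & HK & Hr & IH)].
  - exists 0, 1; repeat split; try lra; constructor.
  - destruct (pointwise_lipschitz _ _ _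
      (ev_derive p (fun u => fst (s u)) (fun u => snd (s u)) h dx dy Hdx Hdy))
      as (Kp & rp & HKp & Hrp & Hp).
    exists (K + Kp), (Rmin r rp); split; [lra | split; [now apply Rmin_pos |]].
    intros k Hk; pose proof (Rmin_l r rp); pose proof (Rmin_r r rp).
    pose proof (Rabs_pos (k - h)).
    constructor.
    + eapply Rle_trans; [apply Hp; lra | nra].
    + apply List.Forall_impl with (2 := IH k ltac:(lra)); intros q Hq; cbv beta in Hq |- *; nra.
Qed.

(** The corrector is evaluated at the two ends s h and s k of an orbit; its coefficients
    are small, and the section is differentiable at h. *)
Lemma corrector_boundary (s : R -> R * R) (h : R) :
  cross_section s -> 0 < h ->
  exists K r, 0 <= K /\ 0 < r /\ forall l k, param_size l <= 1 -> Rabs (k - h) <= r ->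
    Rabs (ev (corrector l) (fst (s k)) (snd (s k)) - ev (corrector l) (fst (s h)) (snd (s h)))
    <= K * param_size l * Rabs (k - h).
Proof.
  intros Hs Hh.
  destruct (section_lipschitz s h
    (prim_null :: prim_second :: prim_x4 :: prim_y4 :: prim_x6 :: prim_cubic :: nil) Hs Hh)
    as (K & r & HK & Hr & HP).
  exists (8 * K), r; split; [lra | split; [exact Hr |]].
  intros l k Hl Hk; specialize (HP k Hk).
  repeat match goal with H : List.Forall _ (_ :: _) |- _ => inversion_clear H end.
  pose proof (Rabs_pos (k - h)) as Hkh.
  pose proof (param_size_l3 l) as Hl3; pose proof (Rabs_pos (l 3%nat)) as Hl30.
  assert (Hc : Rabs (l 3%nat) + Rabs (l 3%nat ^ 2) + Rabs (mu4 l) + Rabs (l 5%nat)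
     + Rabs (l 6%nat) + Rabs (l 3%nat ^ 3) <= 8 * param_size l).
  { assert (Rabs (l 3%nat ^ 2) <= Rabs (l 3%nat)) by (rewrite <- RPow_abs; simpl; nra).
    assert (Rabs (l 3%nat ^ 3) <= Rabs (l 3%nat)).
    { rewrite <- RPow_abs; simpl.
      assert (Rabs (l 3%nat) * (Rabs (l 3%nat) * 1) <= 1) by nra. nra. }
    assert (Rabs (mu4 l) <= Rabs (l 4%nat) + 3 * Rabs (l 3%nat)).
    { unfold mu4; eapply Rle_trans; [apply Rabs_triang |].
      rewrite Rabs_mult, (Rabs_pos_eq 3) by lra; lra. }
    unfold param_size in *; pose proof (fun j => Rabs_pos (l j)) as Hp.
    pose proof (Hp 1%nat); pose proof (Hp 2%nat); pose proof (Hp 4%nat);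
    pose proof (Hp 5%nat); pose proof (Hp 6%nat); lra. }
  apply Rle_trans with ((K * Rabs (k - h)) *
     (Rabs (l 3%nat) + Rabs (l 3%nat ^ 2) + Rabs (mu4 l) + Rabs (l 5%nat)
     + Rabs (l 6%nat) + Rabs (l 3%nat ^ 3))).
  - match goal with |- Rabs ?e <= _ => replace e with
     ((ev prim_null (fst (s k)) (snd (s k)) - ev prim_null (fst (s h)) (snd (s h))) * l 3%nat
     + (ev prim_second (fst (s k)) (snd (s k)) - ev prim_second (fst (s h)) (snd (s h))) * l 3%nat ^ 2
     + (ev prim_x4 (fst (s k)) (snd (s k)) - ev prim_x4 (fst (s h)) (snd (s h))) * mu4 l
     + (ev prim_y4 (fst (s k)) (snd (s k)) - ev prim_y4 (fst (s h)) (snd (s h))) * l 5%nat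
     + (ev prim_x6 (fst (s k)) (snd (s k)) - ev prim_x6 (fst (s h)) (snd (s h))) * l 6%nat
     + (ev prim_cubic (fst (s k)) (snd (s k)) - ev prim_cubic (fst (s h)) (snd (s h))) * l 3%nat ^ 3)
       by (unfold corrector; cbn [ev]; ring) end.
    apply lincomb_bound; assumption.
  - apply Rle_trans with (K * Rabs (k - h) * (8 * param_size l)); [| apply Req_le; ring].
    apply Rmult_le_compat_l; [now apply Rmult_le_pos | exact Hc].
Qed.

(** Integrate [energy_balance] over one turn. The corrector contributes its boundary
    values, which are of the order of param_size * |p - h|; the two remaining
    integrands are replaced by derivatives of [sweep] at the level h. *)
Lemma displacement_estimate (s : R -> R * R) (h eta : R) :
  cross_section s -> 0 < h -> 0 < eta ->
  exists d, 0 < d /\ forall l p, param_size l <= d -> first_return s l h p ->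
    Rabs (p - h - (co2 l h * period_integral 2 h + co0 l h * period_integral 0 h))
    <= eta * (displacement_scale l + Rabs (p - h)).
Proof.
  intros Hs Hh Heta.
  destruct (Hs h Hh) as (_ & _ & Hsh).
  destruct (on_ray_exists (fst (s h)) (snd (s h)) ltac:(lra)) as [c Hc].
  set (A := 2 * h + 1); assert (HA : 1 <= A) by (unfold A; lra).
  assert (HA2 : 1 <= A ^ 2) by (apply pow_R1_Rle; lra).
  (* 36 units of time, two integrands and coefficients of size 5 A^2: 36 * 2 * 5 = 360,
     and a quarter of eta is spent here. *)
  set (e1 := eta / (1440 * A ^ 2)).
  assert (He1 : 0 < e1) by (apply Rdiv_lt_0_compat; lra).
  destruct (level_quadrature 2 h e1 Hh He1) as (d2 & Hd2 & Hq2).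
  destruct (level_quadrature 0 h e1 Hh He1) as (d0 & Hd0 & Hq0).
  destruct (corrector_boundary s h Hs Hh) as (Kc & rc & HKc & Hrc & Hcorr).
  set (D := Rmin (Rmin d2 d0) (Rmin h rc)).
  assert (HD : 0 < D /\ D <= d2 /\ D <= d0 /\ D <= h /\ D <= rc).
  { split; [unfold D; repeat apply Rmin_pos; lra |].
    apply Rle_Rmin4, Rle_refl. }
  clearbody D; destruct HD as (HD & HD2 & HD0 & HDh & HDr).
  destruct (return_is_one_turn s h D c Hs Hh HD Hc) as (C & s0 & K & HC & Hs0 & HK & Hret).
  destruct (remainder_bound A) as (R0 & HR0 & Hrem).
  set (P2 := sqrt (2 * h) ^ 2 * (2 * h)); set (P0 := sqrt (2 * h) ^ 0 * (2 * h)).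
  assert (HP2 : 0 <= P2) by (apply Rmult_le_pos; [apply pow_le, sqrt_pos | lra]).
  assert (HP0 : 0 <= P0) by (apply Rmult_le_pos; [apply pow_le, sqrt_pos | lra]).
  set (M := 180 * A ^ 2 * (P2 + P0) * K * C + 18144 * A ^ 5 * C + 36 * R0 + Kc).
  assert (HA5 : 0 <= A ^ 5 * C) by (apply Rmult_le_pos; [apply pow_le; lra | lra]).
  assert (HAP : 0 <= A ^ 2 * (P2 + P0) * K * C)
    by (repeat apply Rmult_le_pos; lra).
  assert (HM : 0 <= M) by (unfold M; lra).
  exists (Rmin (Rmin s0 1) (Rmin (Rmin d2 d0 / (8 * (1 + A) ^ 2)) (eta / (4 * (M + 1))))).
  assert (H1A : 0 < 8 * (1 + A) ^ 2) by (apply Rmult_lt_0_compat; [lra | apply pow_lt; lra]).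
  split.
  { repeat apply Rmin_pos; try lra; apply Rdiv_lt_0_compat; try lra; apply Rmin_pos; lra. }
  intros l p Hsz Hfr.
  assert (Hsz' : param_size l <= s0 /\ param_size l <= 1
     /\ param_size l <= Rmin d2 d0 / (8 * (1 + A) ^ 2)
     /\ param_size l <= eta / (4 * (M + 1))).
  { now apply Rle_Rmin4. }
  destruct Hsz' as (Hz1 & Hz2 & Hz3 & Hz4); clear Hsz.
  pose proof (param_size_ge0 l) as Hz0; pose proof (displacement_scale_ge0 l) as Hr0.
  destruct (Hret l p Hz1 Hfr)
    as (T & x & y & phi & HT & Ho & Hst & Hend & Hp & Hphi0 & HphiT & Horb).
  assert (Hx0 : x 0 = fst (s h) /\ y 0 = snd (s h)) by (rewrite <- Hst; easy).
  assert (HxT : x T = fst (s p) /\ y T = snd (s p)) by (rewrite <- Hend; easy).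
  assert (H0 : Ham (x 0) (y 0) = h) by (destruct Hx0 as [-> ->]; exact Hsh).
  assert (H1 : Ham (x T) (y T) = p).
  { destruct HxT as [-> ->]; now apply Hs. }
  assert (Hph : Rabs (p - h) <= D /\ Rabs (p - h) <= 36 * (C * param_size l)).
  { destruct (Horb T ltac:(lra)) as (Ha & Hb & _); rewrite H1 in Ha, Hb; split; [exact Ha |].
    eapply Rle_trans; [exact Hb |]. rewrite (Rmult_comm 36).
    apply Rmult_le_compat_l; [now apply Rmult_le_pos | lra]. }
  destruct Hph as [HphD Hphs].
  destruct (co_bound l A h HA ltac:(unfold A; lra)) as [Hco2 Hco0].
  (* [sweep] decreases along the orbit, so the plus signs subtract the two
     integrals at the level h. *)
  set (Z := fun t => Ham (x t) (y t) - ev (corrector l) (x t) (y t)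
      + co2 l h * sweep 2 h (phi t) + co0 l h * sweep 0 h (phi t)).
  set (w := fun t => - kap (x t)
     + damping l (x t) (y t) * (amp (x t) * y t / (2 * Ham (x t) (y t)))).
  set (B := 2 * (7 * A * (36 * (C * param_size l)) * displacement_scale l * A ^ 4
                 + 5 * A ^ 2 * displacement_scale l * e1)
            + R0 * param_size l * displacement_scale l).
  assert (HZ : Rabs (Z T - Z 0) <= B * (T - 0)).
  { apply (mean_value_bound Z (fun t => damping l (x t) (y t) * y t ^ 2
        - full_derivative l (corrector l) (x t) (y t)
        + co2 l h * (profile 2 h (phi t) * w t) + co0 l h * (profile 0 h (phi t) * w t)));
      [lra | |]; intros t Ht; destruct (Horb t Ht) as (Ht1 & Ht2 & Hray & Hw).
    - assert (Hsw : forall i, is_derive (fun u => sweep i h (phi u)) t (profile i h (phi t) * w t)).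
      { intros i.
        apply (is_derive_value _ _ _ _
          (is_derive_comp (sweep i h) phi t _ _ (sweep_derive i h (phi t)) Hw)).
        unfold scal; simpl; unfold mult; simpl; unfold w; ring. }
      apply (is_derive_plus (fun t => Ham (x t) (y t) - ev (corrector l) (x t) (y t)
         + co2 l h * sweep 2 h (phi t))).
      + apply (is_derive_plus (fun t => Ham (x t) (y t) - ev (corrector l) (x t) (y t))).
        * apply (is_derive_minus (fun t => Ham (x t) (y t))).
          -- now apply (orbit_energy_derive l T).
          -- now apply (orbit_ev_derive l T).
        * apply (is_derive_scal (fun u => sweep 2 h (phi u))), Hsw.
      + apply (is_derive_scal (fun u => sweep 0 h (phi u))), Hsw.
    - rewrite energy_balance.
      set (E := Ham (x t) (y t)) in *.
      assert (HE' : 0 <= E <= 2 * h) by (apply Rabs_le_between in Ht1; lra).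
      destruct (box_of_energy (x t) (y t) (2 * h)) as [Hbx Hby]; [apply HE' |].
      fold A in Hbx, Hby.
      assert (HEt : Rabs (E - h) <= 36 * (C * param_size l)).
      { eapply Rle_trans; [exact Ht2 |]; rewrite (Rmult_comm 36).
        apply Rmult_le_compat_l; [now apply Rmult_le_pos | lra]. }
      destruct (co_lipschitz l A E h HA) as [HL2 HL0]; [unfold A; lra | unfold A; lra |].
      specialize (Hrem l (x t) (y t) Hz2 Hbx Hby).
      assert (Hdam : Rabs (damping l (x t) (y t)
            * (amp (x t) * y t / (2 * Ham (x t) (y t)))) <= Rmin d2 d0).
      { destruct (Req_dec E 0) as [HE0 | HEne].
        - change (Ham (x t) (y t)) with E; rewrite HE0, Rmult_0_r, Rdiv_0_r, Rmult_0_r, Rabs_R0.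
          left; now apply Rmin_pos.
        - eapply Rle_trans; [apply angular_speed; change (Ham (x t) (y t)) with E; lra |].
          eapply Rle_trans; [apply damping_bound |].
          change (Ham (x t) (y t)) with E.
          apply Rle_trans with (8 * (1 + A) ^ 2 * (Rmin d2 d0 / (8 * (1 + A) ^ 2))).
          + apply Rmult_le_compat; [| lra | | exact Hz3].
            * apply Rmult_le_pos; [lra | apply pow2_ge_0].
            * apply Rmult_le_compat_l; [lra |]; apply pow_incr; unfold A; lra.
          + apply Req_le; field; lra. }
      pose proof (Rmin_l d2 d0); pose proof (Rmin_r d2 d0).
      assert (Hf2 := Hq2 (x t) (y t) (phi t) _ Hray
        ltac:(fold E; lra) ltac:(eapply Rle_trans; [exact Hdam | lra])).
      assert (Hf0 := Hq0 (x t) (y t) (phi t) _ Hray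
        ltac:(fold E; lra) ltac:(eapply Rle_trans; [exact Hdam | lra])).
      fold (w t) in Hf2, Hf0.
      assert (Hx2 : 0 <= x t ^ 2 * y t ^ 2 <= A ^ 4 /\ 0 <= x t ^ 0 * y t ^ 2 <= A ^ 4).
      { assert (0 <= x t ^ 2 <= A ^ 2) by (apply Rabs_le_between in Hbx; nra).
        assert (0 <= y t ^ 2 <= A ^ 2) by (apply Rabs_le_between in Hby; nra).
        replace (A ^ 4) with (A ^ 2 * A ^ 2) by ring; simpl (x t ^ 0); nra. }
      destruct Hx2 as [Hx2 Hy2].
      match goal with |- Rabs ?e <= _ => replace e with
        ((co2 l E - co2 l h) * (x t ^ 2 * y t ^ 2)
         + co2 l h * (x t ^ 2 * y t ^ 2 + profile 2 h (phi t) * w t)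
         + ((co0 l E - co0 l h) * (x t ^ 0 * y t ^ 2)
         + co0 l h * (x t ^ 0 * y t ^ 2 + profile 0 h (phi t) * w t))
         + remainder l (x t) (y t)) by (simpl (x t ^ 0); ring) end.
      assert (Hmul : forall u v a b, Rabs u <= a -> Rabs v <= b -> Rabs (u * v) <= a * b).
      { intros u v a b Hu Hv; rewrite Rabs_mult; apply Rmult_le_compat; auto using Rabs_pos. }
      assert (Hadd : forall u v a b, Rabs u <= a -> Rabs v <= b -> Rabs (u + v) <= a + b).
      { intros u v a b Hu Hv; pose proof (Rabs_triang u v); lra. }
      assert (HLip : 7 * A * Rabs (E - h) * displacement_scale l
        <= 7 * A * (36 * (C * param_size l)) * displacement_scale l).
      { apply Rmult_le_compat_r; [exact Hr0 |]; apply Rmult_le_compat_l; [lra | exact HEt]. }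
      assert (Ha := Hmul _ _ _ _ (Rle_trans _ _ _ HL2 HLip)
         ltac:(rewrite Rabs_pos_eq; [apply Hx2 | apply Hx2])).
      assert (Hb := Hmul _ _ _ _ (Rle_trans _ _ _ HL0 HLip)
         ltac:(rewrite Rabs_pos_eq; [apply Hy2 | apply Hy2])).
      pose proof (Hadd _ _ _ _ (Hadd _ _ _ _ (Hadd _ _ _ _ Ha (Hmul _ _ _ _ Hco2 Hf2))
         (Hadd _ _ _ _ Hb (Hmul _ _ _ _ Hco0 Hf0))) Hrem) as Hall.
      eapply Rle_trans; [exact Hall |]; apply Req_le; unfold B; ring. }
  assert (HB : 0 <= B).
  { unfold B; assert (0 <= param_size l * displacement_scale l) by now apply Rmult_le_pos.
    assert (0 <= R0 * param_size l * displacement_scale l)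
      by (rewrite Rmult_assoc; now apply Rmult_le_pos).
    assert (0 <= 7 * A * (36 * (C * param_size l)) * displacement_scale l * A ^ 4).
    { repeat apply Rmult_le_pos; try lra; apply pow_le; lra. }
    assert (0 <= 5 * A ^ 2 * displacement_scale l * e1)
      by (apply Rmult_le_pos; [apply Rmult_le_pos |]; lra).
    lra. }
  assert (HZ36 : Rabs (Z T - Z 0) <= B * 36).
  { eapply Rle_trans; [exact HZ |]; apply Rmult_le_compat_l; lra. }
  assert (Hsw : forall i, Rabs (sweep i h (phi T) - sweep i h (c - 2 * PI))
       <= sqrt (2 * h) ^ i * (2 * h) * (K * (36 * (C * param_size l)))).
  { intros i; eapply Rle_trans; [apply sweep_lipschitz, Hh |].
    apply Rmult_le_compat_l; [apply Rmult_le_pos; [apply pow_le, sqrt_pos | lra] |].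
    eapply Rle_trans; [exact HphiT |]; now apply Rmult_le_compat_l. }
  assert (Hs2 := Hsw 2%nat); assert (Hs00 := Hsw 0%nat); fold P2 in Hs2; fold P0 in Hs00.
  specialize (Hcorr l p Hz2 ltac:(lra)).
  pose proof (sweep_turn 2 h c) as Hturn2; pose proof (sweep_turn 0 h c) as Hturn0.
  assert (Heq : p - h - (co2 l h * period_integral 2 h + co0 l h * period_integral 0 h)
    = (Z T - Z 0)
      + (ev (corrector l) (fst (s p)) (snd (s p)) - ev (corrector l) (fst (s h)) (snd (s h)))
      + (- (co2 l h * (sweep 2 h (phi T) - sweep 2 h (c - 2 * PI)))
         + - (co0 l h * (sweep 0 h (phi T) - sweep 0 h (c - 2 * PI))))).
  { rewrite <- Hturn2, <- Hturn0; unfold Z.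
    destruct HxT as [<- <-]; destruct Hx0 as [<- <-]; rewrite H0, H1, Hphi0; ring. }
  rewrite Heq.
  assert (Hmul : forall u v a b, Rabs u <= a -> Rabs v <= b -> Rabs (- (u * v)) <= a * b).
  { intros u v a b Hu Hv; rewrite Rabs_Ropp, Rabs_mult; apply Rmult_le_compat; auto using Rabs_pos. }
  assert (Hadd : forall u v a b, Rabs u <= a -> Rabs v <= b -> Rabs (u + v) <= a + b).
  { intros u v a b Hu Hv; pose proof (Rabs_triang u v); lra. }
  eapply Rle_trans; [apply (Hadd _ _ _ _ (Hadd _ _ _ _ HZ36 Hcorr)
    (Hadd _ _ _ _ (Hmul _ _ _ _ Hco2 Hs2) (Hmul _ _ _ _ Hco0 Hs00))) |].
  assert (HMs : M * param_size l <= eta / 4).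
  { apply Rle_trans with ((M + 1) * (eta / (4 * (M + 1)))).
    - apply Rmult_le_compat; lra.
    - apply Req_le; field; lra. }
  pose proof (Rabs_pos (p - h)) as Hph0.
  apply Rle_trans with
    (M * param_size l * displacement_scale l + 360 * A ^ 2 * e1 * displacement_scale l
     + M * param_size l * Rabs (p - h)).
  { assert (HKcM : Kc * param_size l * Rabs (p - h) <= M * param_size l * Rabs (p - h)).
    { apply Rmult_le_compat_r; [lra |]; apply Rmult_le_compat_r; [lra |]; unfold M; lra. }
    assert (Hmain : B * 36 + (5 * A ^ 2 * displacement_scale l * (P2 * (K * (36 * (C * param_size l))))
        + 5 * A ^ 2 * displacement_scale l * (P0 * (K * (36 * (C * param_size l)))))
       = (M - Kc) * param_size l * displacement_scale l + 360 * A ^ 2 * e1 * displacement_scale l)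
      by (unfold B, M; ring).
    assert (0 <= Kc * (param_size l * displacement_scale l))
      by (apply Rmult_le_pos; [lra | now apply Rmult_le_pos]).
    lra. }
  assert (He1A : 360 * A ^ 2 * e1 = eta / 4) by (unfold e1; field; lra).
  rewrite He1A.
  assert (M * param_size l * displacement_scale l <= eta / 4 * displacement_scale l)
    by now apply Rmult_le_compat_r.
  assert (M * param_size l * Rabs (p - h) <= eta / 4 * Rabs (p - h)) by now apply Rmult_le_compat_r.
  assert (0 <= eta * displacement_scale l) by (apply Rmult_le_pos; lra).
  assert (0 <= eta * Rabs (p - h)) by (apply Rmult_le_pos; lra).
  lra.
Qed.

(** * Independence of the two oval integrals *)

(** All three bounds compare integrands pointwise, after adding multiples of the exact
    derivatives (x y)' = y^2 - x^2 - x^4 and (x^3 y)' = 3 x^2 y^2 - x^4 - x^6. *)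
Lemma period_integral_bounds (s : R -> R * R) (l : nat -> R) (h p : R) :
  (forall j, (1 <= j <= 6)%nat -> l j = 0) -> cross_section s -> 0 < h ->
  first_return s l h p ->
  0 < period_integral 0 h /\
  period_integral 2 h <= 2 * sqrt h * period_integral 0 h /\
  (1 <= h -> sqrt h * period_integral 0 h <= 6 * period_integral 2 h).
Proof.
  intros Hl Hs Hh Hr.
  destruct (closed_oval s l h p Hl Hs Hh Hr) as (T & x & y & HT & Ho & H0 & Hc & Hm).
  destruct (free_orbit_angle (fun _ => 0) T h x y) as [phi Hphi]; auto.
  pose proof (closed_orbit_turn T h x y phi HT Hh Ho H0 Hc Hm Hphi) as Hturn.
  set (N := fun i u => - sweep i h (phi u)).
  assert (HN : forall i t, 0 <= t <= T -> is_derive (N i) t (x t ^ i * y t ^ 2)).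
  { intros i t Ht; destruct (Hphi t Ht) as (H1 & H2 & _).
    apply (free_sweep_derive i (fun _ => 0) T); auto. }
  assert (HNT : forall i, N i T - N i 0 = period_integral i h).
  { intros i; unfold N; rewrite <- (sweep_turn i h (phi 0)), Hturn; ring. }
  assert (HE : forall t, 0 <= t <= T -> 2 * h = y t ^ 2 + x t ^ 2 + x t ^ 4 / 2).
  { intros t Ht; rewrite <- H0, <- (free_orbit_energy (fun _ => 0) T x y t) by auto.
    unfold Ham; field. }
  assert (Hxy : forall t, 0 <= t <= T -> is_derive x t (y t) /\ is_derive y t (- (x t + x t ^ 3))).
  { intros t Ht; destruct (orbit_velocity _ _ _ _ t Ho Ht) as [H1 H2]; split; [exact H1 |].
    apply (is_derive_value _ _ _ _ H2); rewrite damping_zero by auto; ring. }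
  injection Hc as HxT HyT.
  set (q := sqrt h).
  assert (Hq : 0 < q) by now apply sqrt_lt_R0.
  assert (Hqs : q ^ 2 = h) by (apply sqrt_sq; lra).
  assert (Hcomb : forall (a2 a0 b3 b1 b : R),
    (forall t, 0 <= t <= T ->
       0 <= a2 * (x t ^ 2 * y t ^ 2) + a0 * y t ^ 2
            + b3 * (3 * x t ^ 2 * y t ^ 2 - x t ^ 4 - x t ^ 6)
            + b1 * (y t ^ 2 - x t ^ 2 - x t ^ 4) - b) ->
    b * T <= a2 * period_integral 2 h + a0 * period_integral 0 h).
  { intros a2 a0 b3 b1 b Hge.
    rewrite <- (HNT 2%nat), <- (HNT 0%nat).
    set (Z := fun t => a2 * N 2%nat t + a0 * N 0%nat t + b3 * (x t ^ 3 * y t)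
                       + b1 * (x t * y t) - b * t).
    assert (Hmon : Z 0 <= Z T).
    { apply (monotone_of_derive Z _ 0 T (Rlt_le _ _ HT)) with (2 := Hge).
      intros t Ht; destruct (Hxy t Ht) as [Hx Hy].
      pose proof (HN 2%nat t Ht) as H2; pose proof (HN 0%nat t Ht) as H3.
      unfold Z; auto_derive.
      - repeat split; eexists; eassumption.
      - rewrite (Derive_eq _ _ _ H2),
          (Derive_eq _ _ _ H3),
          (Derive_eq _ _ _ Hx),
          (Derive_eq _ _ _ Hy).
        ring. }
    unfold Z in Hmon; rewrite HxT, HyT in Hmon; lra. }
  assert (Hpos : 0 < period_integral 0 h).
  { assert (h * T <= 0 * period_integral 2 h + 1 * period_integral 0 h).
    { apply (Hcomb 0 1 0 (- / 2) h); intros t Ht; specialize (HE t Ht).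
      assert (0 <= x t ^ 4) by (replace (x t ^ 4) with ((x t ^ 2) ^ 2) by ring; apply pow2_ge_0).
      lra. }
    pose proof (Rmult_lt_0_compat _ _ Hh HT); lra. }
  split; [exact Hpos | split].
  - assert (0 * T <= -1 * period_integral 2 h + (2 * q) * period_integral 0 h); [| lra].
    apply (Hcomb (-1) (2 * q) 0 0 0); intros t Ht; specialize (HE t Ht).
    pose proof (pow2_ge_0 (x t)); pose proof (pow2_ge_0 (y t)).
    assert (Hx4 : x t ^ 4 = (x t ^ 2) ^ 2) by ring; rewrite Hx4 in HE.
    assert (x t ^ 2 <= 2 * q) by (rewrite <- Hqs in HE; nra).
    nra.
  - intros H1.
    assert (Hq1 : 1 <= q) by nra.
    set (be := (1 + q) / 4).
    assert (0 * T <= 3 * period_integral 2 h + (be - q) * period_integral 0 h).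
    (* Up to exact terms the integrand is x^2 (1 + x^2) (x^2 - q) plus at least be h,
         and the first product is at least - q^2 (1 + q) / 4. *)
    { apply (Hcomb 3 (be - q) (-1) (q - be / 2) 0); intros t Ht; specialize (HE t Ht).
      pose proof (pow2_ge_0 (x t)).
      assert (Hx4 : x t ^ 4 = (x t ^ 2) ^ 2) by ring.
      assert (Hx6 : x t ^ 6 = (x t ^ 2) ^ 3) by ring.
      rewrite Hx4, Hx6 in *; rewrite <- Hqs in HE.
      set (w := x t ^ 2) in *.
      assert (Hmin : 0 <= w * (1 + w) * (w - q) + be * q ^ 2).
      { unfold be; destruct (Rle_lt_dec q w) as [Hw | Hw].
        - assert (0 <= w * (1 + w)) by nra. nra.
        - assert (w * (q - w) <= q ^ 2 / 4) by (pose proof (pow2_ge_0 (w - q / 2)); nra).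
          assert (0 <= w * (q - w)) by nra.
          assert (w * (q - w) * (1 + w) <= q ^ 2 / 4 * (1 + q)) by (apply Rmult_le_compat; lra).
          lra. }
      assert (Hbe : 0 <= be) by (unfold be; lra).
      assert (be / 2 * (2 * q ^ 2) <= be / 2 * (y t ^ 2 + w + w ^ 2)).
      { apply Rmult_le_compat_l; [lra |]. pose proof (pow2_ge_0 w). lra. }
      nra. }
    assert ((q / 2) * period_integral 0 h <= (q - be) * period_integral 0 h).
    { apply Rmult_le_compat_r; [lra | unfold be; lra]. }
    lra.
Qed.

(** Compare the top term with the others as u tends to infinity, and descend. *)
Lemma dominance_independence (n : nat) (c : nat -> R) (rho : nat -> R -> R) :
  (forall i u, 1 <= u -> / 6 <= rho i u <= 2) ->
  (forall u, 1 <= u -> sum_f_R0 (fun i => c i * rho i u * u ^ i) n = 0) ->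
  forall i, (i <= n)%nat -> c i = 0.
Proof.
  intros Hrho; induction n as [ | n IH]; intros Hsum.
  - intros i Hi; replace i with 0%nat by lia.
    specialize (Hsum 1 (Rle_refl 1)); simpl in Hsum.
    pose proof (Hrho 0%nat 1 (Rle_refl 1)); nra.
  - assert (Htop : c (S n) = 0).
    { set (K := sum_f_R0 (fun i => Rabs (c i) * 2) n).
      assert (HK : 0 <= K) by (apply cond_pos_sum; intros i; pose proof (Rabs_pos (c i)); lra).
      assert (Hb : forall u, 1 <= u -> Rabs (c (S n)) * u <= 6 * K).
      { intros u Hu; specialize (Hsum u Hu); rewrite tech5 in Hsum.
        assert (Hun : 0 < u ^ n) by (apply pow_lt; lra).
        assert (Hlow : Rabs (sum_f_R0 (fun i => c i * rho i u * u ^ i) n) <= K * u ^ n).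
        { eapply Rle_trans; [apply Rsum_abs |].
          unfold K; rewrite Rmult_comm, scal_sum; apply sum_Rle; intros i Hi.
          destruct (Hrho i u Hu) as [Hr1 Hr2].
          rewrite !Rabs_mult, (Rabs_pos_eq (rho i u)), (Rabs_pos_eq (u ^ i))
            by (try apply pow_le; lra).
          pose proof (Rabs_pos (c i)).
          apply Rmult_le_compat; [apply Rmult_le_pos; lra | apply pow_le; lra | |].
          - apply Rmult_le_compat_l; lra.
          - apply Rle_pow; [lra | lia]. }
        assert (Hhigh : Rabs (c (S n) * rho (S n) u * u ^ S n) <= K * u ^ n).
        { replace (c (S n) * rho (S n) u * u ^ S n)
            with (- sum_f_R0 (fun i => c i * rho i u * u ^ i) n) by lra.
          now rewrite Rabs_Ropp. }
        destruct (Hrho (S n) u Hu) as [Hr1 Hr2].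
        rewrite !Rabs_mult, (Rabs_pos_eq (rho (S n) u)), (Rabs_pos_eq (u ^ S n)) in Hhigh
          by (try apply pow_le; lra).
        simpl pow in Hhigh.
        apply Rmult_le_reg_r with (u ^ n); [exact Hun |].
        assert (Hpos : 0 <= Rabs (c (S n)) * u * u ^ n).
        { pose proof (Rabs_pos (c (S n))); repeat apply Rmult_le_pos; lra. }
        nra. }
      destruct (Req_dec (c (S n)) 0) as [H | H]; [exact H | exfalso].
      pose proof (Rabs_pos_lt _ H) as Hc.
      assert (Hq : 0 <= (6 * K) / Rabs (c (S n))) by (apply Rdiv_le_0_compat; lra).
      specialize (Hb (1 + (6 * K) / Rabs (c (S n))) ltac:(lra)).
      rewrite Rmult_plus_distr_l in Hb.
      replace (Rabs (c (S n)) * (6 * K / Rabs (c (S n)))) with (6 * K) in Hb by (field; lra).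
      lra. }
    intros i Hi; destruct (Nat.eq_dec i (S n)) as [-> | Hne]; [exact Htop |].
    apply IH; [| lia].
    intros u Hu; specialize (Hsum u Hu); rewrite tech5 in Hsum; rewrite Htop in Hsum; lra.
Qed.

(** With h = u^2 the quotient J2 / J0 is comparable to u, so the coefficients of J2
    meet odd powers of u and those of J0 even powers: no two terms have the same
    growth. *)
Lemma module_independence (J2 J0 : R -> R) (p2 p1 p0 q2 q1 q0 : R) :
  (forall h, 1 <= h -> 0 < J0 h /\ J2 h <= 2 * sqrt h * J0 h /\ sqrt h * J0 h <= 6 * J2 h) ->
  (forall h, 1 <= h ->
     (p2 * h ^ 2 + p1 * h + p0) * J2 h + (q2 * h ^ 2 + q1 * h + q0) * J0 h = 0) ->
  (p2 = 0 /\ p1 = 0 /\ p0 = 0) /\ (q2 = 0 /\ q1 = 0 /\ q0 = 0).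
Proof.
  intros HJ Heq.
  set (c := fun i => match i with
    | 0%nat => q0 | 1%nat => p0 | 2%nat => q1 | 3%nat => p1 | 4%nat => q2 | _ => p2 end).
  set (rho := fun i u => if Nat.odd i then J2 (u ^ 2) / J0 (u ^ 2) / u else 1).
  assert (H : forall i, (i <= 5)%nat -> c i = 0).
  { apply (dominance_independence 5 c rho).
    - intros i u Hu; unfold rho; destruct (Nat.odd i); [| lra].
      destruct (HJ (u ^ 2) ltac:(nra)) as (H0 & H1 & H2).
      rewrite sqrt_pow2 in H1, H2 by lra.
      assert (Hp : 0 < J0 (u ^ 2) * u) by (apply Rmult_lt_0_compat; lra).
      assert (Hr : J2 (u ^ 2) / J0 (u ^ 2) / u * (J0 (u ^ 2) * u) = J2 (u ^ 2)) by (field; lra).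
      split; apply Rmult_le_reg_r with (J0 (u ^ 2) * u); try exact Hp; rewrite Hr; lra.
    - intros u Hu.
      destruct (HJ (u ^ 2) ltac:(nra)) as (H0 & _).
      specialize (Heq (u ^ 2) ltac:(nra)).
      apply Rmult_eq_reg_r with (J0 (u ^ 2)); [| lra].
      rewrite Rmult_0_l, <- Heq; unfold c, rho; cbn [sum_f_R0].
      change (Nat.odd 0) with false; change (Nat.odd 1) with true; change (Nat.odd 2) with false;
      change (Nat.odd 3) with true; change (Nat.odd 4) with false; change (Nat.odd 5) with true.
      cbv iota; field; split; lra. }
  pose proof (H 0%nat ltac:(lia)); pose proof (H 1%nat ltac:(lia));
  pose proof (H 2%nat ltac:(lia)); pose proof (H 3%nat ltac:(lia));
  pose proof (H 4%nat ltac:(lia)); pose proof (H 5%nat ltac:(lia)).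
  unfold c in *; auto.
Qed.

(** The coefficient at a given order, if b collects the parameters at that order and
    kappa is the contribution of the cubed third parameter. *)
Definition melnikov (J2 J0 : R -> R) (b : nat -> R) (kappa h : R) : R :=
  (lin2 b h + kappa * cub2 h) * J2 h + (lin0 b h + kappa * cub0 h) * J0 h.

(** The parameters b lie on the line spanned by [null_damping]. *)
Definition tangent (b : nat -> R) : Prop :=
  b 1%nat = 0 /\ mu2 b = 0 /\ mu4 b = 0 /\ b 5%nat = 0 /\ b 6%nat = 0.

(** The coefficient of h^2 J2 is a multiple of kappa alone, so kappa vanishes first;
    the linear part then vanishes on a line only. *)
Lemma melnikov_kernel (J2 J0 : R -> R) (b : nat -> R) (kappa : R) :
  (forall h, 1 <= h -> 0 < J0 h /\ J2 h <= 2 * sqrt h * J0 h /\ sqrt h * J0 h <= 6 * J2 h) ->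
  (forall h, 1 <= h -> melnikov J2 J0 b kappa h = 0) ->
  kappa = 0 /\ tangent b.
Proof.
  intros HJ Hz.
  destruct (module_independence J2 J0
    (8 / 1001 * - 308 * kappa)
    (4 / 3 * b 6%nat - 320 / 231 * b 5%nat + 8 / 1001 * - 181 * kappa)
    (32 / 21 * b 6%nat - 40 / 231 * b 5%nat - 8 / 7 * b 4%nat - 3 / 7 * b 3%nat + b 2%nat
       + 8 / 1001 * - 24 * kappa)
    (240 / 77 * b 5%nat + 8 / 1001 * 80 * kappa)
    (- (16 / 21) * b 6%nat + 20 / 231 * b 5%nat + 4 / 7 * b 4%nat + 12 / 7 * b 3%nat
       + 8 / 1001 * 12 * kappa)
    (b 1%nat) HJ) as [(H1 & H2 & H3) (H4 & H5 & H6)].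
  - intros h Hh; rewrite <- (Hz h Hh); unfold melnikov, lin2, lin0, cub2, cub0; ring.
  - unfold tangent, mu2, mu4; repeat split; lra.
Qed.

(** * Leading terms in the small parameter *)

(** f eps = v eps^N + o(eps^N) as eps tends to 0 from the right. *)
Definition leading (f : R -> R) (N : nat) (v : R) : Prop :=
  forall eta, 0 < eta -> exists r, 0 < r /\
    forall eps, 0 < eps < r -> Rabs (f eps - v * eps ^ N) <= eta * eps ^ N.

Lemma leading_unique (f : R -> R) (N : nat) (v w : R) :
  leading f N v -> leading f N w -> v = w.
Proof.
  intros Hv Hw; apply Rminus_diag_uniq.
  destruct (Req_dec (v - w) 0) as [H | H]; [exact H | exfalso].
  pose proof (Rabs_pos_lt _ H) as Hpos.
  destruct (Hv (Rabs (v - w) / 4) ltac:(lra)) as (r1 & Hr1 & H1).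
  destruct (Hw (Rabs (v - w) / 4) ltac:(lra)) as (r2 & Hr2 & H2).
  set (e := Rmin r1 r2 / 2).
  assert (Hm : 0 < Rmin r1 r2) by now apply Rmin_pos.
  pose proof (Rmin_l r1 r2); pose proof (Rmin_r r1 r2).
  specialize (H1 e ltac:(unfold e; lra)); specialize (H2 e ltac:(unfold e; lra)).
  assert (He : 0 < e ^ N) by (apply pow_lt; unfold e; lra).
  assert (Hd : Rabs (v - w) * e ^ N <= Rabs (v - w) / 2 * e ^ N).
  { rewrite <- (Rabs_pos_eq (e ^ N)) at 1 by lra; rewrite <- Rabs_mult.
    replace ((v - w) * e ^ N) with ((f e - w * e ^ N) + - (f e - v * e ^ N)) by ring.
    eapply Rle_trans; [apply Rabs_triang |]; rewrite Rabs_Ropp; lra. }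
  apply Rmult_le_reg_r in Hd; [lra | exact He].
Qed.

Lemma leading_plus (f g : R -> R) (N : nat) (v w : R) :
  leading f N v -> leading g N w -> leading (fun e => f e + g e) N (v + w).
Proof.
  intros Hf Hg eta Heta.
  destruct (Hf (eta / 2) ltac:(lra)) as (r1 & Hr1 & H1).
  destruct (Hg (eta / 2) ltac:(lra)) as (r2 & Hr2 & H2).
  exists (Rmin r1 r2); split; [now apply Rmin_pos |]; intros e He.
  pose proof (Rmin_l r1 r2); pose proof (Rmin_r r1 r2).
  specialize (H1 e ltac:(lra)); specialize (H2 e ltac:(lra)).
  replace (f e + g e - (v + w) * e ^ N)
    with ((f e - v * e ^ N) + (g e - w * e ^ N)) by ring.
  eapply Rle_trans; [apply Rabs_triang |]; lra.
Qed.

Lemma leading_scal (c : R) (f : R -> R) (N : nat) (v : R) :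
  leading f N v -> leading (fun e => c * f e) N (c * v).
Proof.
  intros Hf eta Heta; pose proof (Rabs_pos c) as Hc.
  assert (He : 0 < eta / (Rabs c + 1)) by (apply Rdiv_lt_0_compat; lra).
  destruct (Hf _ He) as (r & Hr & H).
  exists r; split; [exact Hr |]; intros e Hre; specialize (H e Hre).
  replace (c * f e - c * v * e ^ N) with (c * (f e - v * e ^ N)) by ring.
  rewrite Rabs_mult.
  apply Rle_trans with ((Rabs c + 1) * (eta / (Rabs c + 1) * e ^ N)).
  - apply Rmult_le_compat; try apply Rabs_pos; lra.
  - apply Req_le; field; lra.
Qed.

Lemma leading_ext (f g : R -> R) (N : nat) (v w : R) :
  (forall e, f e = g e) -> v = w -> leading f N v -> leading g N w.
Proof.
  intros Hfg <- H eta Heta; destruct (H eta Heta) as (r & Hr & H').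
  exists r; split; [exact Hr |]; intros e He; rewrite <- Hfg; auto.
Qed.

Lemma leading_bound (f : R -> R) (N : nat) (v : R) :
  leading f N v -> exists r, 0 < r /\
    forall e, 0 < e < r -> Rabs (f e) <= (Rabs v + 1) * e ^ N.
Proof.
  intros H; destruct (H 1 Rlt_0_1) as (r & Hr & H'); exists r; split; [exact Hr |].
  intros e He; specialize (H' e He).
  assert (He0 : 0 < e ^ N) by (apply pow_lt; lra).
  replace (f e) with ((f e - v * e ^ N) + v * e ^ N) by ring.
  eapply Rle_trans; [apply Rabs_triang |].
  rewrite Rabs_mult, (Rabs_pos_eq (e ^ N)) by lra; lra.
Qed.

Lemma leading_lower (f : R -> R) (N N' : nat) (v : R) :
  (N < N')%nat -> leading f N' v -> leading f N 0.
Proof.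
  intros HN H eta Heta; destruct (leading_bound f N' v H) as (r & Hr & Hb).
  pose proof (Rabs_pos v) as Hv.
  exists (Rmin r (Rmin 1 (eta / (Rabs v + 1)))); split.
  { repeat apply Rmin_pos; try lra; apply Rdiv_lt_0_compat; lra. }
  intros e He.
  pose proof (Rmin_l r (Rmin 1 (eta / (Rabs v + 1))));
  pose proof (Rmin_r r (Rmin 1 (eta / (Rabs v + 1))));
  pose proof (Rmin_l 1 (eta / (Rabs v + 1))); pose proof (Rmin_r 1 (eta / (Rabs v + 1))).
  specialize (Hb e ltac:(lra)).
  rewrite Rmult_0_l, Rminus_0_r.
  eapply Rle_trans; [exact Hb |].
  replace N' with (1 + (N + (N' - N - 1)))%nat by lia; rewrite !pow_add, pow_1.
  assert (HeN : 0 < e ^ N) by (apply pow_lt; lra).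
  assert (Hp : 0 <= e ^ (N' - N - 1) <= 1).
  { split; [apply pow_le; lra |]. rewrite <- (pow1 (N' - N - 1)); apply pow_incr; lra. }
  assert (Hev : (Rabs v + 1) * e <= eta).
  { apply Rle_trans with ((Rabs v + 1) * (eta / (Rabs v + 1))).
    - apply Rmult_le_compat_l; lra.
    - apply Req_le; field; lra. }
  assert (Hve : 0 <= (Rabs v + 1) * e) by (apply Rmult_le_pos; lra).
  apply Rle_trans with (((Rabs v + 1) * e) * (e ^ N * 1)).
  - rewrite <- Rmult_assoc; apply Rmult_le_compat_l; [exact Hve |].
    apply Rmult_le_compat_l; lra.
  - rewrite Rmult_1_r; apply Rmult_le_compat_r; lra.
Qed.

Lemma leading_cube (f : R -> R) (m : nat) (v : R) :
  leading f m v -> leading (fun e => f e ^ 3) (3 * m) (v ^ 3).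
Proof.
  intros H eta Heta; pose proof (Rabs_pos v) as Hv.
  set (K := 3 * (Rabs v + 1) ^ 2).
  assert (HK : 0 < K) by (unfold K; apply Rmult_lt_0_compat; [lra | apply pow_lt; lra]).
  destruct (H (eta / K) ltac:(apply Rdiv_lt_0_compat; lra)) as (r1 & Hr1 & H1).
  destruct (leading_bound f m v H) as (r2 & Hr2 & H2).
  exists (Rmin r1 r2); split; [now apply Rmin_pos |]; intros e He.
  pose proof (Rmin_l r1 r2); pose proof (Rmin_r r1 r2).
  specialize (H1 e ltac:(lra)); specialize (H2 e ltac:(lra)).
  rewrite Nat.mul_comm, pow_mult; set (E := e ^ m) in *.
  assert (HE : 0 < E) by (apply pow_lt; lra).
  set (F := f e) in *.
  replace (F ^ 3 - v ^ 3 * E ^ 3)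
    with ((F - v * E) * (F * F + F * (v * E) + (v * E) * (v * E))) by ring.
  assert (HvE : Rabs (v * E) <= (Rabs v + 1) * E).
  { rewrite Rabs_mult, (Rabs_pos_eq E) by lra; apply Rmult_le_compat_r; lra. }
  assert (Hmul : forall u w, Rabs u <= (Rabs v + 1) * E -> Rabs w <= (Rabs v + 1) * E ->
            Rabs (u * w) <= ((Rabs v + 1) * E) * ((Rabs v + 1) * E)).
  { intros u w Hu Hw; rewrite Rabs_mult; apply Rmult_le_compat; auto using Rabs_pos. }
  assert (Hsum : Rabs (F * F + F * (v * E) + (v * E) * (v * E)) <= K * E ^ 2).
  { pose proof (Hmul F F H2 H2); pose proof (Hmul F (v * E) H2 HvE);
    pose proof (Hmul (v * E) (v * E) HvE HvE).
    eapply Rle_trans; [apply Rabs_triang |].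
    eapply Rle_trans; [apply Rplus_le_compat_r, Rabs_triang |].
    replace (K * E ^ 2) with (3 * (((Rabs v + 1) * E) * ((Rabs v + 1) * E))) by (unfold K; ring).
    lra. }
  rewrite Rabs_mult.
  apply Rle_trans with ((eta / K * E) * (K * E ^ 2)).
  - apply Rmult_le_compat; auto using Rabs_pos.
  - apply Req_le; field; lra.
Qed.

Lemma locally_0_interval (P : R -> Prop) :
  locally 0 P -> exists r, 0 < r /\ forall e, 0 < e < r -> P e.
Proof.
  intros [r Hr]; exists r; split; [apply cond_pos |]; intros e He; apply Hr.
  unfold ball; simpl; unfold AbsRing_ball, abs, minus, plus, opp; simpl.
  rewrite Rabs_pos_eq; lra.
Qed.

Lemma expansion_at_0 (f : R -> R) (c : nat -> R) : expansion f c -> f 0 = 0.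
Proof.
  intros H; apply locally_singleton in H.
  apply (is_series_unique) in H; rewrite <- H.
  rewrite (Series_ext _ (fun k => 0 * 0)).
  - rewrite Series_scal_l; ring.
  - intros k; simpl; ring.
Qed.

(** The series divided by eps^N is a power series, continuous at 0. *)
Lemma expansion_leading (f : R -> R) (c : nat -> R) (N : nat) :
  expansion f c -> (1 <= N)%nat -> (forall k, (1 <= k < N)%nat -> c k = 0) ->
  leading f N (c N).
Proof.
  intros Hf HN Hc eta Heta.
  destruct (locally_0_interval _ Hf) as (r & Hr & Hser).
  set (g := fun k => c (N + k)%nat).
  assert (Hg : forall e, 0 < e < r -> is_pseries g e (f e / e ^ N)).
  { intros e He; specialize (Hser e He).
    assert (HeN : 0 < e ^ N) by (apply pow_lt; lra).
    apply is_pseries_R.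
    assert (Htail : is_series (fun k => c (N + k)%nat * e ^ (N + k)) (f e)).
    { destruct N as [ | [ | m]]; [lia | exact Hser |].
      assert (Hzero : sum_n (fun k => c (S k) * e ^ S k) (pred (S m)) = 0).
      { rewrite (sum_n_ext_loc _ (fun _ => 0)).
        - rewrite sum_n_const; apply Rmult_0_r.
        - intros k Hk; simpl in Hk; rewrite Hc by lia; apply Rmult_0_l. }
      refine (is_series_incr_n (fun k => c (S k) * e ^ S k) (S m) (f e) ltac:(lia) _).
      match goal with |- is_series _ ?l => assert (Hl : f e = l) end.
      { transitivity (f e + 0); [ring |]; apply (f_equal (Rplus (f e))); symmetry; exact Hzero. }
      rewrite <- Hl; exact Hser. }
    apply (is_series_ext (fun k => / e ^ N * (c (N + k)%nat * e ^ (N + k)))).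
    - intros k; apply Rminus_diag_uniq; unfold g; rewrite pow_add; field; lra.
    - replace (f e / e ^ N) with (/ e ^ N * f e) by (field; lra).
      exact (is_series_scal_l (V := R_NormedModule) (/ e ^ N) _ _ Htail). }
  assert (HCV : Rbar_lt 0 (CV_radius g)).
  { apply CV_radius_pos with (r / 2); [lra |]. eexists; apply Hg; lra. }
  assert (Hcont : continuity_pt (PSeries g) 0).
  { apply (PSeries_continuity g 0); rewrite Rabs_R0; exact HCV. }
  destruct (Hcont eta Heta) as (d & Hd & Hclose).
  exists (Rmin r d); split; [now apply Rmin_pos |]; intros e He.
  pose proof (Rmin_l r d); pose proof (Rmin_r r d).
  specialize (Hg e ltac:(lra)); apply is_pseries_unique in Hg.
  assert (Hq : Rabs (PSeries g e - PSeries g 0) < eta).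
  { apply (Hclose e); split; [split; [exact I | lra] |].
    simpl; unfold Rdist; rewrite Rminus_0_r, Rabs_pos_eq; lra. }
  rewrite Hg, PSeries_0 in Hq; unfold g in Hq; rewrite Nat.add_0_r in Hq.
  assert (HeN : 0 < e ^ N) by (apply pow_lt; lra).
  replace (f e - c N * e ^ N) with ((f e / e ^ N - c N) * e ^ N) by (field; lra).
  rewrite Rabs_mult, (Rabs_pos_eq (e ^ N)) by lra.
  apply Rmult_le_compat_r; lra.
Qed.

Lemma expansion_comb (f g : R -> R) (b c : nat -> R) (t : R) :
  expansion f b -> expansion g c ->
  expansion (fun e => f e + t * g e) (fun k => b k + t * c k).
Proof.
  intros Hf Hg; unfold expansion in *.
  generalize (filter_and _ _ Hf Hg); apply filter_imp; intros e [H1 H2].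
  apply (is_series_ext (fun k => b (S k) * e ^ S k + t * (c (S k) * e ^ S k))).
  - intros k; apply Rminus_diag_uniq; ring.
  - exact (is_series_plus (V := R_NormedModule) _ _ _ _ H1
      (is_series_scal_l (V := R_NormedModule) t _ _ H2)).
Qed.

(** * Determination of the coefficients, order by order *)

(** The coefficient of eps^N in the cube of the third parameter, if that parameter
    vanishes to every order k with 3 k < N. *)
Definition cubic_jet (a : nat -> nat -> R) (N : nat) : R :=
  if (N mod 3 =? 0)%nat then a 3%nat (N / 3)%nat ^ 3 else 0.

Lemma leading_cubic_jet (a : nat -> nat -> R) (f : R -> R) (N : nat) :
  expansion f (a 3%nat) -> (1 <= N)%nat ->
  (forall k, (1 <= k)%nat -> (3 * k < N)%nat -> a 3%nat k = 0) ->
  leading (fun e => f e ^ 3) N (cubic_jet a N).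
Proof.
  intros Hf HN Hz; unfold cubic_jet.
  pose proof (Nat.div_mod_eq N 3) as Hdiv; pose proof (Nat.mod_upper_bound N 3 ltac:(lia)).
  set (m := (N / 3)%nat) in *.
  destruct (Nat.eqb_spec (N mod 3) 0) as [H0 | Hne].
  - replace N with (3 * m)%nat at 1 by lia.
    apply leading_cube, (expansion_leading f (a 3%nat)); [exact Hf | lia |].
    intros k Hk; apply Hz; lia.
  - apply leading_lower with (3 * S m)%nat (a 3%nat (S m) ^ 3); [lia |].
    apply leading_cube, (expansion_leading f (a 3%nat)); [exact Hf | lia |].
    intros k Hk; apply Hz; lia.
Qed.

(** If all lower orders are tangent, the transverse parameters and the cubed third
    parameter are of order eps^N, and so is the displacement; the error of
    [displacement_estimate] is then o(eps^N). *)
Lemma order_step (a : nat -> nat -> R) (lam : nat -> R -> R)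
  (s : R -> R * R) (P : R -> R -> R) (M : nat -> R -> R) (N : nat) (h : R) :
  (forall j, (1 <= j <= 6)%nat -> expansion (lam j) (a j)) ->
  cross_section s -> return_map s lam P -> 0 < h ->
  expansion (fun eps => P h eps - h) (fun k => M k h) ->
  (1 <= N)%nat -> (forall k, (1 <= k < N)%nat -> M k h = 0) ->
  (forall k, (1 <= k < N)%nat -> tangent (fun j => a j k)) ->
  (forall k, (1 <= k)%nat -> (3 * k < N)%nat -> a 3%nat k = 0) ->
  M N h = melnikov (period_integral 2) (period_integral 0) (fun j => a j N) (cubic_jet a N) h.
Proof.
  intros Hlam Hs HP Hh HM HN HM0 Htan Ha3.
  set (le := fun e j => lam j e).
  set (b := fun j => a j N).
  assert (Hd : leading (fun e => P h e - h) N (M N h))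
    by (apply (expansion_leading _ (fun k => M k h)); auto).
  assert (H1 : leading (fun e => le e 1%nat) N (b 1%nat)).
  { apply (expansion_leading _ (a 1%nat)); [apply Hlam; lia | lia |].
    intros k Hk; apply (Htan k Hk). }
  assert (H2 : leading (fun e => mu2 (le e)) N (mu2 b)).
  { apply (expansion_leading _ (fun k => a 2%nat k + 3 * a 3%nat k)); [| lia |].
    - apply (expansion_comb (lam 2%nat) (lam 3%nat)); apply Hlam; lia.
    - intros k Hk; apply (Htan k Hk). }
  assert (H4 : leading (fun e => mu4 (le e)) N (mu4 b)).
  { apply (expansion_leading _ (fun k => a 4%nat k + 3 * a 3%nat k)); [| lia |].
    - apply (expansion_comb (lam 4%nat) (lam 3%nat)); apply Hlam; lia.
    - intros k Hk; apply (Htan k Hk). }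
  assert (H5 : leading (fun e => le e 5%nat) N (b 5%nat)).
  { apply (expansion_leading _ (a 5%nat)); [apply Hlam; lia | lia |].
    intros k Hk; apply (Htan k Hk). }
  assert (H6 : leading (fun e => le e 6%nat) N (b 6%nat)).
  { apply (expansion_leading _ (a 6%nat)); [apply Hlam; lia | lia |].
    intros k Hk; apply (Htan k Hk). }
  assert (H3 : leading (fun e => le e 3%nat ^ 3) N (cubic_jet a N)).
  { apply leading_cubic_jet; [apply Hlam; lia | exact HN | exact Ha3]. }
  set (J2 := period_integral 2); set (J0 := period_integral 0).
  set (kap3 := cubic_jet a N) in *.
  assert (Hmain : leading (fun e => co2 (le e) h * J2 h + co0 (le e) h * J0 h) N
                    (melnikov J2 J0 b kap3 h)).
  (* The coefficients of J2 and J0 rewritten in the transverse parameters. *)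
  { refine (leading_ext _ _ _ _ _ _ _
      (leading_plus _ _ _ _ _ (leading_plus _ _ _ _ _ (leading_plus _ _ _ _ _
      (leading_plus _ _ _ _ _ (leading_plus _ _ _ _ _
        (leading_scal (J0 h) _ _ _ H1) (leading_scal (J2 h) _ _ _ H2))
        (leading_scal (- (8 / 7) * J2 h + 4 / 7 * h * J0 h) _ _ _ H4))
        (leading_scal ((- (320 / 231) * h - 40 / 231) * J2 h
           + (240 / 77 * h ^ 2 + 20 / 231 * h) * J0 h) _ _ _ H5))
        (leading_scal ((4 / 3 * h + 32 / 21) * J2 h - 16 / 21 * h * J0 h) _ _ _ H6))
        (leading_scal (cub2 h * J2 h + cub0 h * J0 h) _ _ _ H3))).
    - intros e; unfold co2, co0, lin2, lin0, mu2, mu4; field.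
    - unfold melnikov, lin2, lin0, mu2, mu4; field. }
  apply (leading_unique (fun e => P h e - h) N); [exact Hd |].
  assert (Hres : exists K r, 0 <= K /\ 0 < r /\ forall e, 0 < e < r ->
     displacement_scale (le e) + Rabs (P h e - h) <= K * e ^ N).
  { destruct (leading_bound _ _ _ H1) as (r1 & Hr1 & B1).
    destruct (leading_bound _ _ _ H2) as (r2 & Hr2 & B2).
    destruct (leading_bound _ _ _ H3) as (r3 & Hr3 & B3).
    destruct (leading_bound _ _ _ H4) as (r4 & Hr4 & B4).
    destruct (leading_bound _ _ _ H5) as (r5 & Hr5 & B5).
    destruct (leading_bound _ _ _ H6) as (r6 & Hr6 & B6).
    destruct (leading_bound _ _ _ Hd) as (r7 & Hr7 & B7).
    eexists; exists (Rmin (Rmin (Rmin r1 r2) (Rmin r3 r4)) (Rmin (Rmin r5 r6) r7)).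
    split; [| split].
    2:{ repeat apply Rmin_pos; assumption. }
    2:{ intros e He.
        pose proof (Rmin_l (Rmin (Rmin r1 r2) (Rmin r3 r4)) (Rmin (Rmin r5 r6) r7)).
        pose proof (Rmin_r (Rmin (Rmin r1 r2) (Rmin r3 r4)) (Rmin (Rmin r5 r6) r7)).
        pose proof (Rmin_l (Rmin r1 r2) (Rmin r3 r4)); pose proof (Rmin_r (Rmin r1 r2) (Rmin r3 r4)).
        pose proof (Rmin_l (Rmin r5 r6) r7); pose proof (Rmin_r (Rmin r5 r6) r7).
        pose proof (Rmin_l r1 r2); pose proof (Rmin_r r1 r2); pose proof (Rmin_l r3 r4);
        pose proof (Rmin_r r3 r4); pose proof (Rmin_l r5 r6); pose proof (Rmin_r r5 r6).
        specialize (B1 e ltac:(lra)); specialize (B2 e ltac:(lra)); specialize (B3 e ltac:(lra));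
        specialize (B4 e ltac:(lra)); specialize (B5 e ltac:(lra)); specialize (B6 e ltac:(lra));
        specialize (B7 e ltac:(lra)).
        unfold displacement_scale.
        eapply Rle_trans.
        { repeat apply Rplus_le_compat; [exact B1 | exact B2 | exact B3 | exact B4
            | exact B5 | exact B6 | exact B7]. }
        rewrite <- !Rmult_plus_distr_r; apply Rle_refl. }
    pose proof (Rabs_pos (b 1%nat)); pose proof (Rabs_pos (mu2 b)); pose proof (Rabs_pos kap3);
    pose proof (Rabs_pos (mu4 b)); pose proof (Rabs_pos (b 5%nat)); pose proof (Rabs_pos (b 6%nat));
    pose proof (Rabs_pos (M N h)); lra. }
  destruct Hres as (K & rK & HK & HrK & Hres).
  intros eta Heta.
  assert (He1 : 0 < eta / (2 * (K + 1))) by (apply Rdiv_lt_0_compat; lra).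
  destruct (displacement_estimate s h _ Hs Hh He1) as (d & Hd0 & Hest).
  assert (Hsmall : exists r, 0 < r /\ forall e, 0 < e < r -> param_size (le e) <= d).
  { assert (Hj : forall j, (1 <= j <= 6)%nat -> exists r, 0 < r /\
        forall e, 0 < e < r -> Rabs (lam j e) <= d / 6).
    { intros j Hj.
      destruct (leading_bound (lam j) 1 (a j 1%nat)) as (r & Hr & B).
      { apply (expansion_leading _ (a j)); [now apply Hlam | lia | intros; lia]. }
      pose proof (Rabs_pos (a j 1%nat)) as Hp.
      exists (Rmin r (d / 6 / (Rabs (a j 1%nat) + 1))); split.
      { apply Rmin_pos; [exact Hr |]; apply Rdiv_lt_0_compat; lra. }
      intros e He.
      pose proof (Rmin_l r (d / 6 / (Rabs (a j 1%nat) + 1)));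
      pose proof (Rmin_r r (d / 6 / (Rabs (a j 1%nat) + 1))).
      eapply Rle_trans; [apply B; lra |]; rewrite pow_1.
      apply Rle_trans with ((Rabs (a j 1%nat) + 1) * (d / 6 / (Rabs (a j 1%nat) + 1))).
      - apply Rmult_le_compat_l; lra.
      - apply Req_le; field; lra. }
    destruct (Hj 1%nat ltac:(lia)) as (r1 & Hr1 & B1).
    destruct (Hj 2%nat ltac:(lia)) as (r2 & Hr2 & B2).
    destruct (Hj 3%nat ltac:(lia)) as (r3 & Hr3 & B3).
    destruct (Hj 4%nat ltac:(lia)) as (r4 & Hr4 & B4).
    destruct (Hj 5%nat ltac:(lia)) as (r5 & Hr5 & B5).
    destruct (Hj 6%nat ltac:(lia)) as (r6 & Hr6 & B6).
    exists (Rmin (Rmin (Rmin r1 r2) (Rmin r3 r4)) (Rmin r5 r6)); split.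
    { repeat apply Rmin_pos; assumption. }
    intros e He.
    pose proof (Rmin_l (Rmin (Rmin r1 r2) (Rmin r3 r4)) (Rmin r5 r6)).
    pose proof (Rmin_r (Rmin (Rmin r1 r2) (Rmin r3 r4)) (Rmin r5 r6)).
    pose proof (Rmin_l (Rmin r1 r2) (Rmin r3 r4)); pose proof (Rmin_r (Rmin r1 r2) (Rmin r3 r4)).
    pose proof (Rmin_l r1 r2); pose proof (Rmin_r r1 r2); pose proof (Rmin_l r3 r4);
    pose proof (Rmin_r r3 r4); pose proof (Rmin_l r5 r6); pose proof (Rmin_r r5 r6).
    specialize (B1 e ltac:(lra)); specialize (B2 e ltac:(lra)); specialize (B3 e ltac:(lra));
    specialize (B4 e ltac:(lra)); specialize (B5 e ltac:(lra)); specialize (B6 e ltac:(lra)).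
    unfold param_size, le; lra. }
  destruct Hsmall as (rs & Hrs & Hsmall).
  destruct (locally_0_interval _ (HP h Hh)) as (rp & Hrp & Hret).
  destruct (Hmain (eta / 2) ltac:(lra)) as (rm & Hrm & Hmain').
  exists (Rmin (Rmin rK rs) (Rmin rp rm)); split; [repeat apply Rmin_pos; assumption |].
  intros e He.
  pose proof (Rmin_l (Rmin rK rs) (Rmin rp rm)); pose proof (Rmin_r (Rmin rK rs) (Rmin rp rm));
  pose proof (Rmin_l rK rs); pose proof (Rmin_r rK rs); pose proof (Rmin_l rp rm);
  pose proof (Rmin_r rp rm).
  specialize (Hres e ltac:(lra)); specialize (Hsmall e ltac:(lra));
  specialize (Hret e ltac:(lra)); specialize (Hmain' e ltac:(lra)).
  specialize (Hest (le e) (P h e) Hsmall Hret).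
  fold J2 J0 in Hest.
  set (W := co2 (le e) h * J2 h + co0 (le e) h * J0 h) in *.
  replace (P h e - h - melnikov J2 J0 b kap3 h * e ^ N)
    with ((P h e - h - W) + (W - melnikov J2 J0 b kap3 h * e ^ N)) by ring.
  eapply Rle_trans; [apply Rabs_triang |].
  assert (HeN : 0 < e ^ N) by (apply pow_lt; lra).
  assert (eta / (2 * (K + 1)) * (displacement_scale (le e) + Rabs (P h e - h)) <= eta / 2 * e ^ N).
  { apply Rle_trans with (eta / (2 * (K + 1)) * ((K + 1) * e ^ N)).
    - apply Rmult_le_compat_l; [lra |].
      eapply Rle_trans; [exact Hres |]; apply Rmult_le_compat_r; lra.
    - apply Req_le; field; lra. }
  lra.
Qed.

Theorem theorem3 (a : nat -> nat -> R) (lam : nat -> R -> R)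
  (s : R -> R * R) (P : R -> R -> R) (M : nat -> R -> R) (n : nat)
  (Hlam : forall j : nat, (1 <= j <= 6)%nat -> expansion (lam j) (a j))
  (Hs : cross_section s)
  (HP : return_map s lam P)
  (HM : forall h : R, 0 < h ->
     expansion (fun eps : R => P h eps - h) (fun k : nat => M k h))
  (Hn : first_nonzero M n) :
  (forall m : nat, n = (3 * m)%nat -> forall h : R, 0 < h ->
     M n h = L a n h
       + 8 / 1001 * a 3%nat m ^ 3
         * (- (308 * h ^ 2 + 181 * h + 24) * I2 h
            + (80 * h ^ 2 + 12 * h) * I0 h)) /\
  (~ Nat.divide 3 n -> forall h : R, 0 < h -> M n h = L a n h).
Proof.
  destruct Hn as (Hn1 & HM0 & _).
  assert (Hl0 : forall j, (1 <= j <= 6)%nat -> lam j 0 = 0).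
  { intros j Hj; apply expansion_at_0 with (a j); auto. }
  assert (Hret0 : forall h, 0 < h -> first_return s (fun j => lam j 0) h (P h 0)).
  { intros h Hh; exact (locally_singleton _ _ (HP h Hh)). }
  assert (HI2 : forall h, 0 < h -> I2 h = period_integral 2 h).
  { intros h Hh; apply (oval_integral_value s (fun j => lam j 0)) with (P h 0); auto. }
  assert (HI0 : forall h, 0 < h -> I0 h = period_integral 0 h).
  { intros h Hh; apply (oval_integral_value s (fun j => lam j 0)) with (P h 0); auto.
    intros; ring. }
  assert (Hbounds : forall h, 1 <= h -> 0 < period_integral 0 h /\
    period_integral 2 h <= 2 * sqrt h * period_integral 0 h /\
    sqrt h * period_integral 0 h <= 6 * period_integral 2 h).
  { intros h Hh.
    destruct (period_integral_bounds s (fun j => lam j 0) h (P h 0)) as (B1 & B2 & B3);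
      auto; try lra. apply Hret0; lra. }
  assert (Hind : forall N, (1 <= N <= n)%nat ->
    (forall k, (1 <= k < N)%nat -> tangent (fun j => a j k)) /\
    (forall k, (1 <= k)%nat -> (3 * k < N)%nat -> a 3%nat k = 0)).
  { induction N as [ | N IH]; [lia | intros HN].
    destruct (Nat.eq_dec N 0) as [-> | HN0]; [split; intros; lia |].
    destruct (IH ltac:(lia)) as [IHt IH3].
    destruct (melnikov_kernel (period_integral 2) (period_integral 0)
       (fun j => a j N) (cubic_jet a N) Hbounds) as [Hk Ht].
    { intros h Hh.
      rewrite <- (order_step a lam s P M N h); auto; try lra; try lia.
      - apply HM0; [lia | lra].
      - apply HM; lra.
      - intros k Hk; apply HM0; [lia | lra]. }
    split.
    - intros k Hk'; destruct (Nat.eq_dec k N) as [-> | Hne]; [exact Ht | apply IHt; lia].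
    - intros k Hk1 Hk3; destruct (Nat.eq_dec (3 * k) N) as [Heq | Hne]; [| apply IH3; lia].
      unfold cubic_jet in Hk; rewrite <- Heq in Hk.
      rewrite Nat.mul_comm, Nat.Div0.mod_mul, Nat.div_mul in Hk by lia; simpl Nat.eqb in Hk.
      cbv iota in Hk.
      destruct (Req_dec (a 3%nat k) 0) as [H | H]; [exact H |].
      exfalso; exact (pow_nonzero _ 3 H Hk). }
  destruct (Hind n ltac:(lia)) as [Ht H3].
  assert (Hfinal : forall h, 0 < h ->
    M n h = melnikov (period_integral 2) (period_integral 0) (fun j => a j n) (cubic_jet a n) h).
  { intros h Hh; apply (order_step a lam s P M n h); auto. }
  split.
  - intros m Hm h Hh; rewrite (Hfinal h Hh).
    assert (Hjet : cubic_jet a n = a 3%nat m ^ 3).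
    { unfold cubic_jet; rewrite Hm, Nat.mul_comm, Nat.Div0.mod_mul, Nat.div_mul by lia; reflexivity. }
    rewrite Hjet; unfold melnikov, L, lin2, lin0, cub2, cub0.
    rewrite (HI2 h Hh), (HI0 h Hh); ring.
  - intros Hdiv h Hh; rewrite (Hfinal h Hh).
    assert (Hjet : cubic_jet a n = 0).
    { unfold cubic_jet; destruct (Nat.eqb_spec (n mod 3) 0) as [H0 | _]; [| reflexivity].
      exfalso; apply Hdiv; exists (n / 3)%nat; pose proof (Nat.div_mod_eq n 3); lia. }
    rewrite Hjet; unfold melnikov, L, lin2, lin0.
    rewrite (HI2 h Hh), (HI0 h Hh); ring.
Qed.
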